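(* For given $n\ge 1$, $N\in R\setminus\{0\}$ and $e\in\{\pm1\}$, there exists a unique isometry class of special lattices of rank $2n+1$, determinant $2N$ and Eichler invariant $e$, provided $e=1$ when $N\in R^\times$.
   Context: $R$ is the ring of integers of a non-archimedean local field $k$ of characteristic $\neq 2$, with valuation $v$ and maximal ideal $p$. Quadratic spaces $(V,Q)$ are regular, with $\langle x,y\rangle=Q(x+y)-Q(x)-Q(y)$. For an $R$-lattice $L$, $L^\vee=\{x:\langle x,y\rangle\in R\ \forall y\in L\}$; $L$ is integral if $Q(L)\subseteq R$. A special lattice is an integral lattice of odd rank with $L^\vee/L$ cyclic. The (signed) determinant of a lattice with basis $v_1,\dots,v_m$ is $(-1)^{\lfloor m/2\rfloor}\det(\langle v_i,v_j\rangle)$, well defined up to squares of units. The Eichler invariant of a special lattice $L$ of determinant $2N$ is $e(L)=1$ if $4N\,Q(x)=1$ for some $x\in L^\vee$, and $e(L)=-1$ otherwise. *)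

(* Defs.v *)
From mathcomp Require Import all_boot all_order all_algebra.
From mathcomp Require Import boolp.
Set Implicit Arguments.
Unset Strict Implicit.
Unset Printing Implicit Defensive.
Import Order.TTheory GRing.Theory Num.Theory.
Local Open Scope ring_scope.

(* A valuation is given by its values on nonzero elements; the value [v 0] is  *)
(* never used, 0 being treated as having infinite valuation.                   *)
Definition vge (k : fieldType) (v : k -> int) (m : int) (x : k) : bool :=
  (x == 0) || (m <= v x).

Definition vring (k : fieldType) (v : k -> int) : {pred k} :=
  [pred x | vge v 0 x].

Definition vmax (k : fieldType) (v : k -> int) : {pred k} :=
  [pred x | vge v 1 x].

Definition vunit (k : fieldType) (v : k -> int) : {pred k} :=
  [pred x | [&& x != 0, x \in vring v & x^-1 \in vring v]].

Definition vcauchy (k : fieldType) (v : k -> int) (u : nat -> k) : Prop :=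
  forall m : int, exists n0 : nat, forall i j : nat,
    (n0 <= i)%N -> (n0 <= j)%N -> vge v m (u i - u j).

Definition vcvg (k : fieldType) (v : k -> int) (u : nat -> k) (l : k) : Prop :=
  forall m : int, exists n0 : nat, forall i : nat,
    (n0 <= i)%N -> vge v m (u i - l).

(* [k] is complete for the normalized discrete valuation [v], with finite      *)
(* residue field (the last clause: finitely many residue classes).             *)
Record is_local_field (k : fieldType) (v : k -> int) : Prop := IsLocalField {
  valM : forall x y : k, x != 0 -> y != 0 -> v (x * y) = v x + v y;
  valD : forall x y : k, x != 0 -> y != 0 -> x + y != 0 ->
    Num.min (v x) (v y) <= v (x + y);
  val_uniformizer : exists2 x : k, x != 0 & v x = 1;
  val_complete : forall u : nat -> k, vcauchy v u -> exists l : k, vcvg v u l;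
  val_residue_finite : exists s : seq k, forall x : k, x \in vring v ->
    exists2 y : k, y \in s & x - y \in vmax v
}.

Definition polar (k : fieldType) (V : vectType k) (Q : V -> k) (x y : V) : k :=
  Q (x + y) - Q x - Q y.

Record quadSpace (k : fieldType) := QuadSpace {
  qs_vect :> vectType k;
  qform : qs_vect -> k;
  qformZ : forall (a : k) (x : qs_vect), qform (a *: x) = a ^+ 2 * qform x;
  polar_linear : forall (a : k) (x y z : qs_vect),
    polar qform (a *: x + y) z = a * polar qform x z + polar qform y z;
  qform_regular : forall x : qs_vect,
    (forall y : qs_vect, polar qform x y = 0) -> x = 0
}.

Definition Rspan (k : fieldType) (v : k -> int) (V : vectType k) (s : seq V)
    (x : V) : Prop :=
  exists2 a : 'I_(size s) -> k,
    forall i, a i \in vring v & x = \sum_(i < size s) a i *: s`_i.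

(* A lattice, bundled with its ambient quadratic space: a finitely generated   *)
(* R-submodule that spans the space over [k].                                  *)
Record lattice (k : fieldType) (v : k -> int) := Lattice {
  lat_space : quadSpace k;
  in_lat : lat_space -> Prop;
  lat_fg : exists s : seq lat_space,
    (forall x, in_lat x <-> Rspan v s x) /\ <<s>>%VS = fullv
}.

Section LatticeNotions.
Variables (k : fieldType) (v : k -> int).
Implicit Type L : lattice v.

Definition lat_form L : lat_space L -> k := @qform k (lat_space L).
Definition lat_pair L : lat_space L -> lat_space L -> k := polar (@lat_form L).

Definition lat_rank L : nat := \dim (fullv : {vspace lat_space L}).

Definition lat_basis L (m : nat) (X : m.-tuple (lat_space L)) : Prop :=
  free X /\ forall x, in_lat x <-> Rspan v X x.

Definition signed_gram_det L (m : nat) (X : m.-tuple (lat_space L)) : k :=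
  (-1) ^+ m./2 * \det (\matrix_(i < m, j < m) lat_pair (tnth X i) (tnth X j)).

(* The signed determinant is a class modulo squares of units of R; this says   *)
(* that the class of [d] is the determinant of [L].                            *)
Definition has_sdet L (d : k) : Prop :=
  exists X : (lat_rank L).-tuple (lat_space L), lat_basis X /\
  exists2 u : k, u \in vunit v & signed_gram_det X = u ^+ 2 * d.

Definition in_dual L (x : lat_space L) : Prop :=
  forall y : lat_space L, in_lat y -> lat_pair x y \in vring v.

Definition integral_lattice L : Prop :=
  forall x : lat_space L, in_lat x -> lat_form x \in vring v.

(* L^\vee / L is a cyclic R-module. *)
Definition dual_quotient_cyclic L : Prop :=
  exists2 x : lat_space L, in_dual x &
    forall y : lat_space L, in_dual y ->
      exists2 a : k, a \in vring v & in_lat (y - a *: x).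

Definition special L : Prop :=
  [/\ integral_lattice L, odd (lat_rank L) & dual_quotient_cyclic L].

(* Meaningful for [L] special of determinant [2 * N]; it only depends on the   *)
(* class of [N] modulo squares of units of R.                                  *)
Definition eichler L (N : k) : int :=
  if `[< exists2 x : lat_space L, in_dual x & 4 * N * lat_form x = 1 >]
  then 1 else -1.

Definition isometric L L' : Prop :=
  exists f : {linear lat_space L -> lat_space L'},
    [/\ bijective f,
        forall x, lat_form (f x) = lat_form x
      & forall x, in_lat (f x) <-> in_lat x].

End LatticeNotions.

(* Main.v *)
Require Import Defs.
From HB Require Import structures.
From mathcomp Require Import all_boot all_order fingroup perm all_algebra.
From mathcomp Require Import boolp ring zify.
Set Implicit Arguments.
Unset Strict Implicit.
Unset Printing Implicit Defensive.
Import Order.TTheory GRing.Theory Num.Theory.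
Local Open Scope ring_scope.

(* As [2 != 0], a lattice with a basis is its Gram matrix [B] up to congruence *)
(* by [GL_m(R)]. Cyclicity of the discriminant module bounds the corank of [B] *)
(* modulo [p] by one, so binary unimodular blocks can be split off, and each   *)
(* of them is [x^2 + x y + c y^2] for some [c]. A vector that is isotropic     *)
(* modulo [p] and pairs to a unit with the lattice lifts, by Hensel, to an     *)
(* isotropic one and splits off a hyperbolic plane. Since binary forms over    *)
(* the residue field represent all nonzero values, this leaves only            *)
(* [H^n _|_ <N>] and, when [N] lies in [p], [H^(n-1) _|_ W _|_ <N / (1 - 4c)>] *)
(* with [W] the norm form of the unramified quadratic extension; a counting    *)
(* argument makes [W] unique. The two are told apart by the Eichler invariant: *)
(* on the second, [4 N Q(x) = 1] would make [1 - 4c] a square modulo [4 p].    *)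

(** The argument has three layers. [lattice_classified_by_matrix] turns lattices into Gram matrices
    up to [cong]. [nf_classify] shows that rank and determinant leave at most two congruence classes
    of even matrices with cyclic discriminant module. [eichmx_nf] and [eichmx_as2] compute the
    Eichler invariant, which is [1] on the first normal form and [-1] on the second; existence and
    uniqueness follow together.

    The heart is [nf_exists]. [cyclicmx_unit_entry] finds a unit in a Gram matrix of rank at least
    two, which yields a binary unimodular summand, and [cong_as2] brings it to [x^2 + x y + c y^2].
    Together with its complement this summand nearly always contains a vector that [cong_split_hyp2]
    turns into a hyperbolic plane. The only obstruction is in rank three, when [t^2 + t + c] has no
    root modulo [p] and the remaining coefficient lies in [p].

    Values of [x - x^2] take the place of squares, so that residue characteristic two leads to the
    same normal forms. The facts needed about them are the count [card_asim] and its consequences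
    [rootless_equiv] (uniqueness of the anisotropic plane) and [binary_rep] (binary forms represent
    everything modulo [p]). *)

Lemma mem_cast (T : Type) (S : {pred T}) x y : x \in S -> x = y -> y \in S.
Proof. by move=> ? <-. Qed.

(** * The valuation ring *)

Section LocalField.
Variables (k : fieldType) (v : k -> int) (hk : is_local_field v).
Local Notation R := (vring v).
Local Notation p := (vmax v).
Local Notation U := (vunit v).

Lemma val1 : v 1 = 0.
Proof.
have n1 : (1 : k) != 0 by exact: oner_neq0.
by have := Defs.valM hk n1 n1; rewrite mulr1; lia.
Qed.

Lemma valN x : x != 0 -> v (- x) = v x.
Proof.
move=> x0; have n1 : (-1 : k) != 0 by rewrite oppr_eq0 oner_neq0.
have := Defs.valM hk n1 n1; rewrite mulrNN mulr1 val1 => h.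
by rewrite -mulN1r (Defs.valM hk n1 x0); lia.
Qed.

Lemma vge0 m : vge v m 0. Proof. by rewrite /vge eqxx. Qed.

Lemma vgeN m x : vge v m x -> vge v m (- x).
Proof.
rewrite /vge oppr_eq0; case: eqVneq => //= x0; by rewrite valN.
Qed.

Lemma vgeD m x y : vge v m x -> vge v m y -> vge v m (x + y).
Proof.
rewrite /vge; have [->|x0] /= := eqVneq x 0; first by rewrite add0r.
have [->|y0] /= := eqVneq y 0; first by rewrite addr0 (negbTE x0).
have [//|xy0] /= := eqVneq (x + y) 0 => mx my.
by apply: le_trans (Defs.valD hk x0 y0 xy0); rewrite le_min mx.
Qed.

Lemma vgeM m m' x y : vge v m x -> vge v m' y -> vge v (m + m') (x * y).
Proof.
rewrite /vge mulf_eq0; have [->|x0] //= := eqVneq x 0.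
have [->|y0] //= := eqVneq y 0 => mx my.
by rewrite (Defs.valM hk x0 y0) lerD.
Qed.

Lemma vge_le m m' x : m <= m' -> vge v m' x -> vge v m x.
Proof. by move=> mm; rewrite /vge; case: eqVneq => //= _; apply: le_trans. Qed.

Lemma vring_subring : subring_closed R.
Proof.
split=> [|x y xR yR|x y xR yR]; rewrite inE.
- by rewrite /vge val1 lexx orbT.
- exact: vgeD xR (vgeN yR).
- by have := vgeM xR yR; rewrite addr0.
Qed.

HB.instance Definition _ := GRing.isSubringClosed.Build k R vring_subring.

Lemma vmax_zmod : zmod_closed p.
Proof.
split=> [|x y xR yR]; rewrite inE; first exact: vge0.
exact: vgeD xR (vgeN yR).
Qed.

HB.instance Definition _ := GRing.isZmodClosed.Build k p vmax_zmod.

Lemma vmaxMl x y : x \in p -> y \in R -> x * y \in p.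
Proof. by move=> xp yR; have := vgeM xp yR; rewrite addr0. Qed.

Lemma vmaxMr x y : x \in R -> y \in p -> x * y \in p.
Proof. by move=> ? ?; rewrite mulrC vmaxMl. Qed.

Lemma vmaxR x : x \in p -> x \in R.
Proof. exact: vge_le. Qed.

Lemma vunitE x : (x \in U) = (x != 0) && (v x == 0).
Proof.
rewrite !inE /vge; case: eqVneq => //= x0.
rewrite invr_eq0 (negbTE x0) /=.
have := Defs.valM hk x0 (invr_neq0 x0); rewrite divff // val1; lia.
Qed.

Lemma vunitP x : (x \in U) = (x \in R) && (x \notin p).
Proof. by rewrite vunitE !inE /vge; case: eqVneq => //= x0; lia. Qed.

Lemma vunitR x : x \in U -> x \in R. Proof. by rewrite vunitP => /andP[]. Qed.
Lemma vunit_neq0 x : x \in U -> x != 0. Proof. by rewrite vunitE => /andP[]. Qed.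

Lemma vunitV x : x \in U -> x^-1 \in R. Proof. by case/and3P. Qed.
Lemma vunitVU x : x \in U -> x^-1 \in U.
Proof. by case/and3P=> ? ? ?; rewrite !inE invrK invr_eq0; apply/and3P. Qed.

Lemma vunitM x y : x \in U -> y \in U -> x * y \in U.
Proof.
by rewrite !vunitE => /andP[x0 /eqP vx] /andP[y0 /eqP vy];
  rewrite mulf_neq0 // (Defs.valM hk) // vx vy.
Qed.

Lemma vunitD_vmax x y : x \in U -> y \in p -> x + y \in U.
Proof.
move=> xU yp; move: xU; rewrite !vunitP => /andP[xR xp].
rewrite (rpredD xR (vmaxR yp)) /=.
by apply: contra xp => h; rewrite -(addrK y x) rpredB.
Qed.

Lemma vring_unit x : x \in R -> x \in U \/ x \in p.
Proof. by rewrite vunitP => ->; case: (x \in p); [right|left]. Qed.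

(** The map [t |-> (r - d t^2) / u] is a contraction of [p]: the difference of two values has the
    factor [t + t'], which lies in [p]. Completeness gives the fixed point. *)
Lemma hensel d u r : d \in R -> u \in U -> r \in p ->
  exists2 t, t \in p & d * t ^+ 2 + u * t = r.
Proof.
move=> dR uU rp; have u0 := vunit_neq0 uU; have uV := vunitV uU.
pose t i := iter i (fun t => (r - d * t ^+ 2) / u) 0.
have tS i : t i.+1 = (r - d * t i ^+ 2) / u by [].
have tp i : t i \in p.
  elim: i => [|i IH]; first exact: rpred0.
  rewrite tS vmaxMl // rpredB // vmaxMr // expr2 vmaxMl //; exact: vmaxR.
have step i : vge v i.+1%:Z (t i.+1 - t i).
  elim: i => [|i IH]; first by rewrite subr0; exact: tp.
  have -> : t i.+2 - t i.+1 = (t i.+1 - t i) * ((t i.+1 + t i) * (- d / u)).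
    by rewrite !tS; field.
  rewrite -addn1 PoszD; apply: vgeM => //.
  by rewrite -[vge _ _ _]/(_ \in p) vmaxMl ?rpredD // rpredM // rpredN.
have dist i j : vge v i.+1%:Z (t (i + j)%N - t i).
  elim: j => [|j IH]; first by rewrite addn0 subrr vge0.
  rewrite addnS -(subrK (t (i + j)%N) (t (i + j).+1)) -addrA.
  by apply: vgeD IH; apply: vge_le (step _); lia.
have cau : vcauchy v t.
  move=> m; exists `|m|%N => i j mi mj.
  have h l : (`|m| <= l)%N -> vge v m (t l - t `|m|%N).
    by move=> ml; rewrite -(subnKC ml); apply: vge_le (dist _ _); lia.
  have -> : t i - t j = (t i - t `|m|%N) - (t j - t `|m|%N) by ring.
  by apply: vgeD; [|apply: vgeN]; apply: h.
have [l lim] := val_complete hk cau.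
have lp : l \in p.
  have [n0 /(_ n0 (leqnn _)) h] := lim 1.
  by rewrite -(subKr (t n0) l); apply: rpredB.
exists l => //; apply/eqP; rewrite -subr_eq0; apply/negPn/negP => z0.
set z := _ - r in z0.
have [n0 h] := lim (v z + 1).
have : vge v (v z + 1) z.
  (* The defect of the limit is a combination of two approximation errors with coefficients in [R],
     so its valuation would exceed itself. *)
  have ez : z = (t n0.+1 - l) * (- u) + (t n0 - l) * (- d * (t n0 + l)).
    by rewrite /z tS; field.
  rewrite [X in vge _ _ X]ez.
  rewrite -[v z + 1]addr0; apply: vgeD; apply: vgeM; try exact: h.
    by rewrite -[vge _ _ _]/(_ \in R) rpredN vunitR.
  by rewrite -[vge _ _ _]/(_ \in R) rpredM ?rpredN // rpredD // vmaxR.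
by rewrite /vge (negbTE z0) /=; lia.
Qed.

Lemma vmax_prime x y : x \in R -> y \in R -> x * y \in p -> x \in p \/ y \in p.
Proof.
move=> xR yR xyp; have [xU|] := vring_unit xR; last by left.
by right; rewrite -(mulKf (vunit_neq0 xU) y) vmaxMr // vunitV.
Qed.

Lemma vmax1 : (1 \in p) = false.
Proof. by rewrite inE /vge oner_eq0 val1. Qed.

Lemma vunit1 : 1 \in U.
Proof. by rewrite vunitP vmax1 rpred1. Qed.

(** * The residue field *)

(** Only counting in [R / p] is needed, so the residue field is replaced by a finite type of classes
    with a choice of representatives [r] and a reduction map [rep]. *)
Lemma residue_reps : exists (I : finType) (r : I -> k) (rep : k -> I),
  [/\ forall i, r i \in R, forall x, x \in R -> x - r (rep x) \in p
    & forall i j, r i - r j \in p -> i = j].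
Proof.
have [s0 hs0] := val_residue_finite hk.
(* The given list may contain non-integral or congruent elements; these are dropped one by one. *)
have [s [sR scov suniq]] : exists s : seq k,
    [/\ {subset s <= R},
        forall x, x \in R -> (exists2 y, y \in s0 & x - y \in p) ->
          has (fun y => x - y \in p) s
      & forall y z, y \in s -> z \in s -> y - z \in p -> y = z].
  elim: s0 {hs0} => [|y s0 [s [sR scov suniq]]].
    by exists [::]; split=> // x _ [].
  have [yR|yR] := boolP (y \in R); last first.
    exists s; split=> // x xR [z]; rewrite inE => /orP[/eqP-> xyp|zs xzp].
      by case/negP: yR; rewrite -(subKr x y) rpredB // vmaxR.
    by apply: scov => //; exists z.
  have [|ncov] := boolP (has (fun z => y - z \in p) s).
    case/hasP=> z zs yzp; exists s; split=> // x xR [w].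
    rewrite inE => /orP[/eqP-> xyp|ws xwp]; last by apply: scov => //; exists w.
    by apply/hasP; exists z => //; rewrite -(subrK y x) -addrA rpredD.
  exists (y :: s); split=> [x||].
  - by rewrite inE => /orP[/eqP->|/sR].
  - move=> x xR [w]; rewrite inE /= => /orP[/eqP->->//|ws xwp].
    by rewrite scov ?orbT //; exists w.
  - move=> a b; rewrite !in_cons => /orP[/eqP->|sa] /orP[/eqP->|sb] //.
    + by move=> h; case/hasP: ncov; exists b.
    + by rewrite -opprB rpredN => h; case/hasP: ncov; exists a.
    + exact: suniq.
have cov x : x \in R -> has (fun y => x - y \in p) s.
  by move=> xR; apply: scov => //; apply: hs0.
pose nx (x : k) := nth 0 s (find (fun y => x - y \in p) s).
have nxs x : x \in R -> nx x \in s.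
  by move=> xR; rewrite mem_nth // -has_find cov.
pose i0 : seq_sub s := SeqSub (nxs _ (rpred0 _)).
exists (seq_sub s), (fun i => val i), (fun x => insubd i0 (nx x)).
split=> [[i /= /sR]|x xR|i j h] //.
- by rewrite insubdK ?nxs //; apply: (nth_find 0 (cov _ xR)).
- by apply/val_inj/suniq => //; apply: valP.
Qed.

Section Residue.
Variables (I : finType) (r : I -> k) (rep : k -> I).
Hypotheses (rR : forall i, r i \in R)
  (rrep : forall x, x \in R -> x - r (rep x) \in p)
  (rinj : forall i j, r i - r j \in p -> i = j).

Lemma rep_eq x y : x \in R -> y \in R -> x - y \in p -> rep x = rep y.
Proof.
move=> xR yR xyp; apply: rinj.
have -> : r (rep x) - r (rep y) = (y - r (rep y)) - (x - r (rep x)) + (x - y).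
  by ring.
by rewrite rpredD // rpredB // rrep.
Qed.

Lemma rep_inj x y : x \in R -> y \in R -> rep x = rep y -> x - y \in p.
Proof.
move=> xR yR e.
have -> : x - y = (x - r (rep x)) - (y - r (rep x)) by ring.
by rewrite rpredB ?rrep // e rrep.
Qed.

Lemma repK i : rep (r i) = i.
Proof. by apply: rinj; rewrite -opprB rpredN rrep. Qed.

(* The Artin-Schreier type map [x |-> x - x^2], its image, and the fixed       *)
(* points of [x |-> 1 - x]. In odd residue characteristic it is, up to an      *)
(* affine change of variables, the squaring map.                               *)
Definition asf i := rep (r i - r i ^+ 2).
Definition asim := asf @: [set: I].
Definition asfix := [set i | 1 - 2 * r i \in p].

Lemma asR i : r i - r i ^+ 2 \in R.
Proof. by rewrite rpredB ?rpredX. Qed.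

Lemma asim_rep x : x \in R ->
  rep x \in asim <-> exists2 t, t \in R & t ^+ 2 + t + x \in p.
Proof.
move=> xR; split=> [/imsetP[i _ e]|[t tR tp]].
  exists (- r i); first by rewrite rpredN.
  by apply: mem_cast (rep_inj xR (asR i) e) _; ring.
apply/imsetP; exists (rep (- t)) => //.
have tR' : - t \in R by rewrite rpredN.
apply: rep_eq => //; first exact: asR.
set y := rep _; have h := rrep tR'; rewrite -/y in h.
have -> : x - (r y - r y ^+ 2) = (t ^+ 2 + t + x) + (- t - r y) * (1 - r y + t).
  by ring.
by rewrite rpredD // vmaxMl // !rpredD ?rpredN ?rpred1.
Qed.

Lemma asf_fiber i j : asf i = asf j -> i = j \/ i = rep (1 - r j).
Proof.
move=> e; have := rep_inj (asR i) (asR j) e.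
have -> : r i - r i ^+ 2 - (r j - r j ^+ 2) = (r i - r j) * (1 - r j - r i).
  by ring.
case/vmax_prime => [||h|h]; [by rewrite rpredB|by rewrite !rpredB ?rpred1| |].
  by left; apply: rinj.
right.
rewrite -[LHS]repK; apply: rep_eq => //; first by rewrite rpredB ?rpred1.
by rewrite -opprB rpredN.
Qed.

(* The reflection [x |-> 1 - x] exchanges the points of each fibre of           *)
(* [x |-> x - x^2], so a section of that map and its reflection cover           *)
(* everything, the fixed points twice.                                          *)
Lemma card_asim : (#|I| + #|asfix| <= 2 * #|asim|)%N.
Proof.
pose sg i := rep (1 - r i).
have oR i : 1 - r i \in R by rewrite rpredB ?rpred1.
have sgK i : sg (sg i) = i.
  rewrite /sg -[RHS]repK; apply: rep_eq => //.
  by apply: mem_cast (rrep (oR i)) _; ring.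
(* A section of [asf]; the default is never reached, as [g] is only applied to values of [asf]. *)
pose g s := odflt (rep 0) [pick i | asf i == s].
have gP i : asf (g (asf i)) = asf i.
  by rewrite /g; case: pickP => [j /eqP//|/(_ i)]; rewrite eqxx.
pose A := g @: asim; pose B := sg @: A.
have cov : A :|: B = [set: I].
  apply/setP => i; rewrite !inE; have Ag : g (asf i) \in A.
    by apply: imset_f; apply: imset_f.
  case: (asf_fiber (esym (gP i))) => e; apply/orP; [left|right].
    by rewrite e.
  by rewrite e; apply: imset_f.
have sub : asfix \subset A :&: B.
  apply/subsetP => i; rewrite inE => iD.
  have si : sg i = i.
    rewrite /sg -[RHS]repK; apply: rep_eq => //.
    by apply: mem_cast iD _; ring.
  have : i \in A :|: B by rewrite cov inE.
  have AB : i \in A -> i \in B by move=> iA; rewrite -si imset_f.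
  rewrite !inE => /orP[iA|iB]; first by rewrite iA AB.
  have iA : i \in A by case/imsetP: (iB) => a aA ia; rewrite -si ia sgK.
  by rewrite iA.
have := cardsUI A B; rewrite cov cardsT => e.
have := subset_leq_card sub.
have : (#|A| <= #|asim|)%N := leq_imset_card _ _.
have : (#|B| <= #|A|)%N := leq_imset_card _ _.
move: e; set x1 := #|I|; set x2 := #|A :&: B|; set x3 := #|A|; lia.
Qed.

End Residue.

(** Irreducibility of [t^2 + t + c] over the residue field: [x^2 + x y + c y^2] is then anisotropic
    modulo [p]. *)
Definition rootless c := [/\ c \in R & forall t, t \in R -> t ^+ 2 + t + c \notin p].

(** The map [x |-> x - x^2] takes the same value at 0 and 1, so on a finite set it is not
    surjective; a class outside its image works. *)
Lemma rootless_exists : exists c, rootless c.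
Proof.
have [I [r [rep [rR rrep rinj]]]] := residue_reps.
have [e|] := eqVneq (asim r rep) [set: I].
  have : #|asim r rep| == #|[set: I]| by rewrite e.
  move/imset_injP/(_ (rep 0) (rep 1)); rewrite !inE => /(_ isT isT) h.
  have : rep 0 = rep 1.
    apply: h; apply: (rep_eq rrep rinj); rewrite ?(asR rR) //.
    have h0 := rrep _ (rpred0 _); have h1 := rrep _ (rpred1 _).
    set a := r (rep 0) in h0 *; set b := r (rep 1) in h1 *.
    have -> : a - a ^+ 2 - (b - b ^+ 2) = (0 - a) * (a - 1) - (1 - b) * b by ring.
    have aR : a \in R := rR _; have bR : b \in R := rR _.
    by apply: rpredB; rewrite vmaxMl // rpredB ?rpred1.
  move/(rep_inj rrep (rpred0 _) (rpred1 _)).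
  by rewrite sub0r rpredN vmax1.
rewrite eqEsubset subsetT /= => /subsetPn[i _ iS]; exists (r i); split=> // t tR.
apply: contra iS => h; rewrite -(repK rR rrep rinj i).
by apply/(asim_rep rR rrep rinj (rR i)); exists t.
Qed.

Lemma vring_nat m : m%:R \in R.
Proof. exact: rpred_nat. Qed.

(** If [1 - 4 c] were in [p], then 2 would be a unit and [-1/2] a double root modulo [p]. *)
Lemma rootless_disc c : rootless c -> 1 - 4 * c \in U.
Proof.
case=> cR hc; have [//|dp] := vring_unit (rpredB (rpred1 R) (rpredM (vring_nat 4) cR)).
have [u2|p2] := vring_unit (vring_nat 2); last first.
  have : 1 - 4 * c + 2 * (2 * c) \in p.
    by rewrite rpredD // vmaxMl // rpredM // vring_nat.
  by rewrite (_ : _ + _ = 1) ?vmax1 //; ring.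
have n2 := vunit_neq0 u2.
have := hc (- 2^-1); rewrite rpredN vunitV // => /(_ isT)/negP[].
have -> : (- 2^-1) ^+ 2 - 2^-1 + c = - (1 - 4 * c) * (2^-1 * 2^-1) by field.
by rewrite vmaxMl ?rpredN // rpredM // vunitV.
Qed.

(** The right-hand side is the value of [x^2 + x y + c y^2] at [(b, 1 - 2 b)]. Modulo [p], such
    values with [1 - 2 b] a unit are rootless, and a count shows that they exhaust the rootless
    classes; Hensel's lemma then makes the congruence an equality. *)
Lemma rootless_equiv c c' : rootless c -> rootless c' ->
  exists b, [/\ b \in R, 1 - 2 * b \in U & c' = c + (1 - 4 * c) * (b - b ^+ 2)].
Proof.
move=> hc hc'; have dU := rootless_disc hc; have [cR nc] := hc; have [c'R nc'] := hc'.
have dR := vunitR dU; have d0 := vunit_neq0 dU.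
have [I [r [rep [rR rrep rinj]]]] := residue_reps.
pose S := asim r rep; pose D := asfix r.
pose S' := S :\: (asf r rep @: D).
pose g s := rep (c + (1 - 4 * c) * r s).
have gR s : c + (1 - 4 * c) * r s \in R by rewrite rpredD // rpredM.
have ginj : injective g.
  move=> s s' /(rep_inj rrep (gR _) (gR _)).
  have -> : c + (1 - 4 * c) * r s - (c + (1 - 4 * c) * r s') =
    (1 - 4 * c) * (r s - r s') by ring.
  case/vmax_prime => // [|h|]; [by rewrite rpredB| |exact: rinj].
  by move: dU; rewrite vunitP h andbF.
have D'P s : s \in S' ->
    exists b, [/\ b \in R, 1 - 2 * b \in U & (b - b ^+ 2) - r s \in p].
  rewrite !inE => /andP[sD /imsetP[i _ e]]; exists (r i); split=> //.
    rewrite vunitP rpredB ?rpred1 ?rpredM ?vring_nat //=; apply: contra sD => h.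
    by rewrite e imset_f // inE.
  by rewrite e; apply: rrep; exact: (asR rR).
have sub : g @: S' \subset ~: S.
  apply/subsetP => _ /imsetP[s sS' ->]; rewrite inE; apply/negP.
  have [b [bR bU bs]] := D'P _ sS'.
  case/(asim_rep rR rrep rinj (gR s)) => t tR tp.
  have qR : (t + b) / (1 - 2 * b) \in R by rewrite rpredM ?rpredD ?vunitV.
  case/negP: (nc _ qR).
  have b0 := vunit_neq0 bU.
  (* A root [t] for the new constant gives the root [(t + b) / (1 - 2 b)] for [c]. *)
  have -> : ((t + b) / (1 - 2 * b)) ^+ 2 + (t + b) / (1 - 2 * b) + c =
    ((t ^+ 2 + t + (c + (1 - 4 * c) * r s)) + (b - b ^+ 2 - r s) * (1 - 4 * c))
     * ((1 - 2 * b)^-1 * (1 - 2 * b)^-1) by field.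
  by rewrite vmaxMl ?rpredM ?vunitV // rpredD // vmaxMl.
(* Here [#|S'| >= #|S| - #|D|], and [card_asim] bounds this below by [#|I| - #|S|]. *)
have eS : g @: S' = ~: S.
  apply/eqP; rewrite eqEcard sub card_imset // cardsCs setCK.
  have := card_asim rR rrep rinj; rewrite -/S -/D => h1.
  have := leq_imset_card (asf r rep) D.
  have := cardsID (asf r rep @: D) S; rewrite -/S'.
  have := subset_leq_card (subsetIr S (asf r rep @: D)).
  move: h1; move: #|S'| #|S| #|D| #|_ :&: _| #|asf r rep @: D| #|I| => *; lia.
have : rep c' \in ~: S.
  by rewrite inE; apply/negP => /(asim_rep rR rrep rinj c'R)[t tR]; apply/negP/nc'.
rewrite -eS => /imsetP[s sS' /(rep_inj rrep c'R (gR _)) e].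
have [b [bR bU bs]] := D'P _ sS'.
have rp : (c' - c) / (1 - 4 * c) - (b - b ^+ 2) \in p.
  have -> : (c' - c) / (1 - 4 * c) - (b - b ^+ 2) =
   (c' - (c + (1 - 4 * c) * r s)) * (1 - 4 * c)^-1 - (b - b ^+ 2 - r s) by field.
  by rewrite rpredB // vmaxMl // vunitV.
have [t tp e'] := hensel (rpredN1 R) bU rp.
exists (b + t); split.
- by rewrite rpredD // vmaxR.
- have -> : 1 - 2 * (b + t) = (1 - 2 * b) + - 2 * t by ring.
  by rewrite vunitD_vmax // vmaxMr // rpredN vring_nat.
- have -> : b + t - (b + t) ^+ 2 =
    (-1 * t ^+ 2 + (1 - 2 * b) * t) + (b - b ^+ 2) by ring.
  by rewrite e'; field.
Qed.

(** If [a] is in [p], then [b] is a unit and the equation is linear modulo [p] once [y = 1]. If [a]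
    is a unit and 2 is in [p], squaring is bijective on residues and [y = 0] suffices. Otherwise one
    completes the square and uses the pigeonhole principle. *)
Lemma binary_rep a b c u : a \in R -> b \in R -> c \in R -> b ^+ 2 - 4 * a * c \in U ->
  u \in R -> exists x y, [/\ x \in R, y \in R &
    a * x ^+ 2 + b * x * y + c * y ^+ 2 - u \in p].
Proof.
move=> aR bR cR dU uR; have dR := vunitR dU.
have [aU|ap] := vring_unit aR; last first.
  have [bU|bp] := vring_unit bR; last first.
    move: dU; rewrite vunitP => /andP[_ /negP[]].
    apply: rpredB; first by rewrite expr2 vmaxMl.
    by rewrite vmaxMl // vmaxMr // vring_nat.
  have qR : (u - c) / b \in R by rewrite rpredM ?rpredB ?vunitV.
  exists ((u - c) / b), 1; split=> //; first exact: rpred1.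
  have b0 := vunit_neq0 bU.
  have -> : a * ((u - c) / b) ^+ 2 + b * ((u - c) / b) * 1 + c * 1 ^+ 2 - u =
    a * ((u - c) / b) ^+ 2 by field.
  by rewrite vmaxMl // rpredX.
have a0 := vunit_neq0 aU.
have [I [r [rep [rR rrep rinj]]]] := residue_reps.
have [u2|p2] := vring_unit (vring_nat 2); last first.
  pose h i := rep (r i ^+ 2).
  have hR i : r i ^+ 2 \in R by rewrite rpredX.
  have hinj : injective h.
    move=> i j /(rep_inj rrep (hR _) (hR _)) e; apply: rinj.
    have : (r i - r j) * (r i - r j) \in p.
      have -> : (r i - r j) * (r i - r j) =
        r i ^+ 2 - r j ^+ 2 + 2 * (r j * (r j - r i)) by ring.
      by rewrite rpredD // vmaxMl // rpredM // rpredB.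
    by case/vmax_prime => //; rewrite rpredB.
  have uaR : u / a \in R by rewrite rpredM // vunitV.
  have [h' _ /(_ (rep (u / a))) e] := injF_bij hinj.
  exists (r (h' (rep (u / a)))), 0; split; rewrite ?rpred0 //.
  have {}e := rep_inj rrep (hR _) uaR e.
  by apply: mem_cast (vmaxMr aR e) _; field.
have n2 := vunit_neq0 u2.
have e4 : 4 = 2 * 2 :> k by ring.
have n4 : 4 != 0 :> k by rewrite e4 mulf_neq0.
have q4 : 4^-1 = 2^-1 * 2^-1 :> k by rewrite e4 invfM.
set d := _ - _ in dU dR.
(* With [X = 2 a x + b y], the equation is [X^2 - d y^2 = 4 a u]. Writing [X = 1 - 2 i] and
   [y = 1 - 2 j] turns it into [i - i^2 = e + d (j - j^2)]. *)
pose e := (1 - d - 4 * a * u) * 4^-1.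
have eR : e \in R.
  by rewrite rpredM // ?q4 1?rpredM ?vunitV // !rpredB ?rpred1 // !rpredM // vring_nat.
pose g s := rep (e + d * r s).
have gR s : e + d * r s \in R by rewrite rpredD // rpredM.
have ginj : injective g.
  move=> s s' /(rep_inj rrep (gR _) (gR _)).
  have -> : e + d * r s - (e + d * r s') = d * (r s - r s') by ring.
  case/vmax_prime => // [|h|]; [by rewrite rpredB| |exact: rinj].
  by move: dU; rewrite vunitP h andbF.
pose S := asim r rep.
(* The class of [1/2] is fixed by the reflection, so [card_asim] gives [2 * #|S| > #|I|], and [S]
   meets its image under the injection [g]. *)
have [s [sS gsS]] : exists s, s \in S /\ g s \in S.
  have D0 : (0 < #|asfix r|)%N.
    apply/card_gt0P; exists (rep 2^-1); rewrite inE.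
    have -> : 1 - 2 * r (rep 2^-1) = 2 * (2^-1 - r (rep 2^-1)) by field.
    by rewrite vmaxMr ?vring_nat // rrep // vunitV.
  have := card_asim rR rrep rinj; rewrite -/S => h1.
  have h2 := cardsUI S (g @: S); rewrite (card_imset _ ginj) in h2.
  have h3 := max_card (mem (S :|: g @: S)).
  have : (0 < #|S :&: g @: S|)%N.
    move: h1 h2 h3 D0; clear.
    by move: #|S| #|_ :&: _| #|_ :|: _| #|asfix r| #|I|; lia.
  case/card_gt0P=> z; rewrite inE => /andP[zS /imsetP[s sS ez]].
  by exists s; rewrite -ez.
case/imsetP: sS => j _ /= es.
case/imsetP: gsS => i _ /= eg.
have h1 := rrep _ (asR rR j); rewrite -[rep _]/(asf r rep j) -es in h1.
have h2 := rep_inj rrep (gR _) (asR rR i) eg.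
pose X := 1 - 2 * r i; pose Y := 1 - 2 * r j.
have XR : X \in R by rewrite rpredB ?rpred1 ?rpredM ?vring_nat.
have YR : Y \in R by rewrite rpredB ?rpred1 ?rpredM ?vring_nat.
exists ((X - b * Y) * (2^-1 * a^-1)), Y; split=> //.
  by rewrite !rpredM ?vunitV // rpredB // rpredM.
have -> : a * ((X - b * Y) * (2^-1 * a^-1)) ^+ 2 +
  b * ((X - b * Y) * (2^-1 * a^-1)) * Y + c * Y ^+ 2 - u =
  ((e + d * r s - (r i - r i ^+ 2)) + (r j - r j ^+ 2 - r s) * d) * a^-1.
  by rewrite /X /Y /e /d; field; rewrite ?a0 ?n2 ?n4.
by rewrite vmaxMl ?vunitV // rpredD // vmaxMl.
Qed.
(** * Congruence of Gram matrices *)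

Definition mx2 (a b c d : k) : 'M[k]_2 :=
  \matrix_(i, j) if i == 0 then (if j == 0 then a else b)
                 else (if j == 0 then c else d).

Lemma ord2E (i : 'I_2) : i = 0 \/ i = 1.
Proof. by case: i => [[|[|//]] Hi]; [left|right]; apply: val_inj. Qed.

Lemma mx2P (A B : 'M[k]_2) : A 0 0 = B 0 0 -> A 0 1 = B 0 1 -> A 1 0 = B 1 0 ->
  A 1 1 = B 1 1 -> A = B.
Proof.
by move=> *; apply/matrixP => i j; case: (ord2E i) => ->; case: (ord2E j) => ->.
Qed.

Lemma sum2 (F : 'I_2 -> k) : \sum_i F i = F 0 + F 1.
Proof. by rewrite big_ord_recl big_ord1; congr (_ + F _); apply: val_inj. Qed.

Lemma mul_mx2 a b c d a' b' c' d' : mx2 a b c d *m mx2 a' b' c' d' =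
  mx2 (a * a' + b * c') (a * b' + b * d') (c * a' + d * c') (c * b' + d * d').
Proof. by apply: mx2P; rewrite !mxE sum2 !mxE. Qed.

Lemma tr_mx2 a b c d : (mx2 a b c d)^T = mx2 a c b d.
Proof. by apply: mx2P; rewrite !mxE. Qed.

Lemma det_mx2 a b c d : \det (mx2 a b c d) = a * d - b * c.
Proof.
rewrite (expand_det_row _ 0) sum2 /cofactor !det_mx11 !mxE /=.
by ring.
Qed.

Lemma mxOver_tr m n (A : 'M[k]_(m, n)) : A \is a mxOver R -> A^T \is a mxOver R.
Proof. by move/mxOverP => h; apply/mxOverP => i j; rewrite mxE. Qed.

Lemma mxOver_row m n1 n2 (A : 'M[k]_(m, n1)) (B : 'M[k]_(m, n2)) :
  (row_mx A B \is a mxOver R) = (A \is a mxOver R) && (B \is a mxOver R).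
Proof.
apply/mxOverP/andP => [h|[/mxOverP hA /mxOverP hB] i j].
  by split; apply/mxOverP => i j;
    [have := h i (lshift n2 j)|have := h i (rshift n1 j)]; rewrite ?row_mxEl ?row_mxEr.
by rewrite mxE; case: splitP.
Qed.

Lemma mxOver_col m1 m2 n (A : 'M[k]_(m1, n)) (B : 'M[k]_(m2, n)) :
  (col_mx A B \is a mxOver R) = (A \is a mxOver R) && (B \is a mxOver R).
Proof.
apply/mxOverP/andP => [h|[/mxOverP hA /mxOverP hB] i j].
  by split; apply/mxOverP => i j;
    [have := h (lshift m2 i) j|have := h (rshift m1 i) j]; rewrite ?col_mxEu ?col_mxEd.
by rewrite mxE; case: splitP.
Qed.

Lemma mxOver_block m1 m2 n1 n2 (A : 'M[k]_(m1, n1)) (B : 'M[k]_(m1, n2))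
    (C : 'M[k]_(m2, n1)) (D : 'M[k]_(m2, n2)) :
  (block_mx A B C D \is a mxOver R) =
  [&& A \is a mxOver R, B \is a mxOver R, C \is a mxOver R & D \is a mxOver R].
Proof. by rewrite /block_mx mxOver_col !mxOver_row -andbA. Qed.

Lemma mxOver_zero m n : (0 : 'M[k]_(m, n)) \is a mxOver R.
Proof. exact: mxOver0 (rpred0 _). Qed.

Lemma mxOver_one m : (1%:M : 'M[k]_m) \is a mxOver R.
Proof. by apply: mxOver_scalar; rewrite ?rpred0 ?rpred1. Qed.

Lemma mxOver_delta m n i j : (delta_mx i j : 'M[k]_(m, n)) \is a mxOver R.
Proof. by apply/mxOverP => a b; rewrite mxE rpred_nat. Qed.

Lemma mxOver_mx2 a b c d : a \in R -> b \in R -> c \in R -> d \in R ->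
  mx2 a b c d \is a mxOver R.
Proof. by move=> *; apply/mxOverP => i j; rewrite mxE; do 2!case: ifP. Qed.

Lemma mxOver_det m (A : 'M[k]_m) : A \is a mxOver R -> \det A \in R.
Proof.
move/mxOverP => h; apply: rpred_sum => s _.
by rewrite rpredMsign; apply: rpred_prod => i _; apply: h.
Qed.

Lemma mxOver_adj m (A : 'M[k]_m) : A \is a mxOver R -> \adj A \is a mxOver R.
Proof.
move/mxOverP => h; apply/mxOverP => i j; rewrite mxE /cofactor rpredMsign.
by apply/mxOver_det/mxOverP => a b; rewrite !mxE.
Qed.

Definition GLR m (A : 'M[k]_m) : Prop :=
  A \is a mxOver R /\ exists2 A', A' \is a mxOver R & A *m A' = 1%:M.

Lemma GLR_over m (A : 'M[k]_m) : GLR A -> A \is a mxOver R.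
Proof. by case. Qed.

Lemma GLR_inv m (A : 'M[k]_m) : GLR A ->
  exists A', [/\ GLR A', A *m A' = 1%:M & A' *m A = 1%:M].
Proof.
move=> [oA [A' oA' e]]; exists A'; split=> //; last exact: mulmx1C.
by split=> //; exists A => //; exact: mulmx1C.
Qed.

Lemma GLR_mul m (A B : 'M[k]_m) : GLR A -> GLR B -> GLR (A *m B).
Proof.
move=> [oA [A' oA' eA]] [oB [B' oB' eB]]; split; first exact: mxOverM.
by exists (B' *m A'); rewrite ?mxOverM // mulmxA -(mulmxA A) eB mulmx1.
Qed.

Lemma GLR_one m : GLR (1%:M : 'M[k]_m).
Proof. by split; [|exists 1%:M]; rewrite ?mulmx1 ?mxOver_one. Qed.

Lemma GLR_tr m (A : 'M[k]_m) : GLR A -> GLR A^T.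
Proof.
move=> [oA [A' oA' e]]; split; first exact: mxOver_tr.
by exists A'^T; rewrite ?mxOver_tr // -trmx_mul (mulmx1C e) trmx1.
Qed.

Lemma GLR_block m1 m2 (A : 'M[k]_m1) (B : 'M[k]_m2) :
  GLR A -> GLR B -> GLR (block_mx A 0 0 B).
Proof.
move=> [oA [A' oA' eA]] [oB [B' oB' eB]]; split.
  by rewrite mxOver_block oA oB !mxOver_zero.
exists (block_mx A' 0 0 B'); first by rewrite mxOver_block oA' oB' !mxOver_zero.
by rewrite mulmx_block !mul0mx !mulmx0 !addr0 !add0r eA eB -scalar_mx_block.
Qed.

Lemma GLR_det m (A : 'M[k]_m) : GLR A -> \det A \in U.
Proof.
move=> [oA [A' oA' e]]; have := congr1 (@determinant k m) e.
rewrite det_mulmx det1 => e1.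
rewrite vunitP mxOver_det //=; apply/negP => dp.
by have := vmaxMl dp (mxOver_det oA'); rewrite e1 vmax1.
Qed.

Lemma GLR_of_det m (A : 'M[k]_m) : A \is a mxOver R -> \det A \in U -> GLR A.
Proof.
move=> oA dU; split=> //; exists ((\det A)^-1 *: \adj A).
  by rewrite mxOverZ ?vunitV // mxOver_adj.
by rewrite -scalemxAr mul_mx_adj scale_scalar_mx mulVf // vunit_neq0.
Qed.

Definition cong m (B C : 'M[k]_m) : Prop := exists2 A, GLR A & C = A *m B *m A^T.

Lemma cong_refl m (B : 'M[k]_m) : cong B B.
Proof. by exists 1%:M; rewrite ?trmx1 ?mulmx1 ?mul1mx //; apply: GLR_one. Qed.

Lemma cong_sym m (B C : 'M[k]_m) : cong B C -> cong C B.
Proof.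
move=> [A /GLR_inv[A' [gA' e e']] ->]; exists A' => //.
by rewrite !mulmxA e' mul1mx -mulmxA -trmx_mul e' trmx1 mulmx1.
Qed.

Lemma cong_trans m (B C D : 'M[k]_m) : cong B C -> cong C D -> cong B D.
Proof.
move=> [A gA ->] [A' gA' ->]; exists (A' *m A); first exact: GLR_mul.
by rewrite trmx_mul !mulmxA.
Qed.

Lemma cong_block m1 m2 (P P' : 'M[k]_m1) (D D' : 'M[k]_m2) : cong P P' -> cong D D' ->
  cong (block_mx P 0 0 D) (block_mx P' 0 0 D').
Proof.
move=> [A gA ->] [A' gA' ->]; exists (block_mx A 0 0 A'); first exact: GLR_block.
by rewrite tr_block_mx !trmx0 !mulmx_block !(mul0mx, mulmx0, addr0, add0r).
Qed.

Lemma cong_det m (B C : 'M[k]_m) :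
  cong B C -> exists2 u, u \in U & \det C = u ^+ 2 * \det B.
Proof.
move=> [A gA ->]; exists (\det A); first exact: GLR_det.
by rewrite !det_mulmx det_tr; ring.
Qed.

(* The Gram matrices of integral lattices: [C] is a matrix of the form [Q].    *)
Definition evenmx m (B : 'M[k]_m) : Prop := exists2 C, C \is a mxOver R & B = C + C^T.

Lemma evenmx_cong m (B C : 'M[k]_m) : cong B C -> evenmx B -> evenmx C.
Proof.
move=> [A [oA _] ->] [F oF ->]; exists (A *m F *m A^T).
  by rewrite !mxOverM ?mxOver_tr.
by rewrite mulmxDr mulmxDl !trmx_mul trmxK mulmxA.
Qed.

Lemma evenmx_sym m (B : 'M[k]_m) : evenmx B -> B^T = B.
Proof. by move=> [C _ ->]; rewrite linearD /= trmxK addrC. Qed.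

Lemma evenmx_over m (B : 'M[k]_m) : evenmx B -> B \is a mxOver R.
Proof. by move=> [C oC ->]; rewrite rpredD ?mxOver_tr. Qed.

Lemma evenmx_block m1 m2 (P : 'M[k]_m1) (D : 'M[k]_m2) :
  evenmx (block_mx P 0 0 D) <-> evenmx P /\ evenmx D.
Proof.
split=> [[C]|[[C oC ->] [C' oC' ->]]].
  rewrite -(submxK C) mxOver_block tr_block_mx add_block_mx.
  move=> /and4P[o1 _ _ o4] /eq_block_mx[eP _ _ eD].
  by split; [exists (ulsubmx C)|exists (drsubmx C)].
exists (block_mx C 0 0 C'); first by rewrite mxOver_block oC oC' !mxOver_zero.
by rewrite tr_block_mx add_block_mx !trmx0 !addr0.
Qed.

Definition bf m (B : 'M[k]_m) (x y : 'rV[k]_m) : k := (x *m B *m y^T) 0 0.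
Definition qf m (B : 'M[k]_m) (x : 'rV[k]_m) : k := bf B x x / 2.

Lemma bf_delta m (B : 'M[k]_m) x j : bf B x 'e_j = (x *m B) 0 j.
Proof. by rewrite /bf trmx_delta -colE mxE. Qed.

Lemma bf_delta2 m (B : 'M[k]_m) i j : bf B 'e_i 'e_j = B i j.
Proof. by rewrite bf_delta -rowE mxE. Qed.

Lemma bfDl m (B : 'M[k]_m) x x' y : bf B (x + x') y = bf B x y + bf B x' y.
Proof. by rewrite /bf !mulmxDl mxE. Qed.

Lemma bfDr m (B : 'M[k]_m) x y y' : bf B x (y + y') = bf B x y + bf B x y'.
Proof. by rewrite /bf linearD /= mulmxDr mxE. Qed.

Lemma bfZl m (B : 'M[k]_m) a x y : bf B (a *: x) y = a * bf B x y.
Proof. by rewrite /bf -!scalemxAl mxE. Qed.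

Lemma bfZr m (B : 'M[k]_m) a x y : bf B x (a *: y) = a * bf B x y.
Proof. by rewrite /bf linearZ /= -scalemxAr mxE. Qed.

Lemma bfC m (B : 'M[k]_m) x y : B^T = B -> bf B x y = bf B y x.
Proof.
move=> sB; rewrite /bf -[in RHS](trmxK (y *m B *m x^T)) [RHS]mxE.
by rewrite !trmx_mul trmxK sB mulmxA.
Qed.

Lemma bf_cong m (A B : 'M[k]_m) x y : bf (A *m B *m A^T) x y = bf B (x *m A) (y *m A).
Proof. by rewrite /bf trmx_mul !mulmxA. Qed.

Lemma congE m (A B : 'M[k]_m) i j : (A *m B *m A^T) i j = bf B (row i A) (row j A).
Proof. by rewrite -bf_delta2 bf_cong -!rowE. Qed.

Lemma bf_block m1 m2 (P : 'M[k]_m1) (D : 'M[k]_m2) x y x' y' :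
  bf (block_mx P 0 0 D) (row_mx x y) (row_mx x' y') = bf P x x' + bf D y y'.
Proof.
by rewrite /bf mul_row_block !mulmx0 addr0 add0r tr_row_mx mul_row_col mxE.
Qed.

Lemma qf_block m1 m2 (P : 'M[k]_m1) (D : 'M[k]_m2) x y :
  qf (block_mx P 0 0 D) (row_mx x y) = qf P x + qf D y.
Proof. by rewrite /qf bf_block mulrDl. Qed.

(** The entries of [x *m B] are the pairings of [x] with the basis vectors. *)
Definition dualv m (B : 'M[k]_m) (x : 'rV[k]_m) : Prop := x *m B \is a mxOver R.

Definition cyclicmx m (B : 'M[k]_m) : Prop :=
  exists2 x, dualv B x & forall y, dualv B y ->
    exists2 a, a \in R & y - a *: x \is a mxOver R.

Lemma dualv_cong m (A B : 'M[k]_m) x :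
  GLR A -> dualv (A *m B *m A^T) x <-> dualv B (x *m A).
Proof.
move=> gA; have gT := GLR_tr gA; rewrite /dualv !mulmxA.
split=> [h|h]; last by rewrite mxOverM // GLR_over.
have [A' [gA' e _]] := GLR_inv gT.
by rewrite -[_ *m B]mulmx1 -e mulmxA mxOverM // GLR_over.
Qed.

Lemma cyclicmx_cong m (B C : 'M[k]_m) : cong B C -> cyclicmx B -> cyclicmx C.
Proof.
move=> [A gA ->] [x dx hx]; have [A' [gA' e e']] := GLR_inv gA.
exists (x *m A'); first by apply/dualv_cong; rewrite // -mulmxA e' mulmx1.
move=> y /(dualv_cong _ _ gA) /hx[a aR h]; exists a => //.
have -> : y - a *: (x *m A') = (y *m A - a *: x) *m A'.
  by rewrite mulmxBl -mulmxA e mulmx1 scalemxAl.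
by rewrite mxOverM // GLR_over.
Qed.

Lemma dualv_block m1 m2 (P : 'M[k]_m1) (D : 'M[k]_m2) x y :
  dualv (block_mx P 0 0 D) (row_mx x y) <-> dualv P x /\ dualv D y.
Proof.
rewrite /dualv mul_row_block !mulmx0 addr0 add0r mxOver_row.
by split=> [/andP|[-> ->]].
Qed.

Lemma cyclicmx_block m1 m2 (P : 'M[k]_m1) (D : 'M[k]_m2) :
  cyclicmx (block_mx P 0 0 D) -> cyclicmx D.
Proof.
move=> [x]; rewrite -(hsubmxK x) => /dualv_block[_ dx] hx.
exists (rsubmx x) => // y dy; have [|a aR] := hx (row_mx 0 y).
  by apply/dualv_block; split=> //; rewrite /dualv mul0mx mxOver_zero.
rewrite scale_row_mx opp_row_mx add_row_mx mxOver_row => /andP[_ h].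
by exists a.
Qed.

Lemma GLR_dualv m (P : 'M[k]_m) x : GLR P -> dualv P x -> x \is a mxOver R.
Proof.
move=> [_ [P' oP' e]] dx.
by rewrite -[x]mulmx1 -e mulmxA mxOverM.
Qed.

Lemma cyclicmx_block_unit m1 m2 (P : 'M[k]_m1) (D : 'M[k]_m2) :
  GLR P -> cyclicmx D -> cyclicmx (block_mx P 0 0 D).
Proof.
move=> gP [x dx hx]; exists (row_mx 0 x).
  by apply/dualv_block; split=> //; rewrite /dualv mul0mx mxOver_zero.
move=> y; rewrite -(hsubmxK y) => /dualv_block[dl /hx[a aR h]]; exists a => //.
by rewrite scale_row_mx opp_row_mx add_row_mx mxOver_row h scaler0 subr0 (GLR_dualv gP).
Qed.

(** A unimodular block can be used as a pivot: subtracting [V' P^-1] times the upper rows clears the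
    off-diagonal blocks. *)
Lemma cong_schur m1 m2 (B : 'M[k]_(m1 + m2)) : evenmx B -> GLR (ulsubmx B) ->
  exists D, cong B (block_mx (ulsubmx B) 0 0 D).
Proof.
move=> eB; set P := ulsubmx B => gP.
pose V := ursubmx B; pose V' := dlsubmx B; pose D := drsubmx B.
have BE : B = block_mx P V V' D by rewrite submxK.
have /eq_block_mx[sP _ sU _] : block_mx P^T V'^T V^T D^T = block_mx P V V' D.
  by rewrite -tr_block_mx -BE evenmx_sym.
have : block_mx P V V' D \is a mxOver R by rewrite -BE evenmx_over.
rewrite mxOver_block => /and4P[oP oV oV' oD].
have [P' [gP' e e']] := GLR_inv gP.
have oP' := GLR_over gP'.
have sP' : P'^T = P'.
  by rewrite -[LHS]mulmx1 -e mulmxA -{1}sP -trmx_mul e trmx1 mul1mx.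
exists (D - V' *m P' *m V), (block_mx 1%:M 0 (- (V' *m P')) 1%:M).
  split; first by rewrite mxOver_block !mxOver_one mxOver_zero rpredN mxOverM.
  exists (block_mx 1%:M 0 (V' *m P') 1%:M).
    by rewrite mxOver_block !mxOver_one mxOver_zero mxOverM.
  rewrite mulmx_block !(mul0mx, mulmx0, addr0, add0r, mulmx1, mul1mx).
  by rewrite addNr -scalar_mx_block.
rewrite [in RHS]BE tr_block_mx !trmx1 trmx0 linearN /= trmx_mul sP'.
rewrite !mulmx_block !(mul0mx, mulmx0, addr0, add0r, mulmx1, mul1mx).
rewrite !mulNmx !mulmxN !mulmxA -(mulmxA V' P' P) e' mulmx1 addNr mul0mx.
by rewrite -sU trmxK e mul1mx addNr mul0mx oppr0 add0r addrC.
Qed.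

Lemma cong_perm m (B : 'M[k]_m) (s : 'S_m) : cong B (\matrix_(i, j) B (s i) (s j)).
Proof.
exists (perm_mx s).
  split; first by apply/mxOverP => i j; rewrite !mxE rpred_nat.
  exists (perm_mx s)^T; first by apply/mxOverP => i j; rewrite !mxE rpred_nat.
  by rewrite tr_perm_mx -perm_mxM mulgV perm_mx1.
by rewrite tr_perm_mx -col_permE -row_permE; apply/matrixP => i j; rewrite !mxE.
Qed.

Lemma cong_split2 m (B : 'M[k]_(2 + m)) i j : evenmx B -> i != j ->
  B i i * B j j - B i j * B j i \in U ->
  exists D, cong B (block_mx (mx2 (B i i) (B i j) (B j i) (B j j)) 0 0 D).
Proof.
move=> eB ij uB.
pose o0 : 'I_(2 + m) := lshift m 0; pose o1 : 'I_(2 + m) := lshift m 1.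
have o10 : o1 != o0 by [].
(* The permutation [s] sends the first two indices to [i] and [j]; [j'] is the position of [j] after
   the first transposition. *)
pose s1 := tperm o0 i; pose j' := s1 j; pose s := (tperm o1 j' * s1)%g.
have j'0 : j' != o0.
  apply: contraNneq ij => e; rewrite -[j](tpermK o0 i) -/s1 -/j' e.
  by rewrite /s1 tpermL.
have s0 : s o0 = i by rewrite permM tpermD // /s1 tpermL.
have s1E : s o1 = j by rewrite permM tpermL /j' /s1 tpermK.
pose C := \matrix_(a, b) B (s a) (s b).
have cC : cong B C := cong_perm B s.
have eC := evenmx_cong cC eB.
have ul : ulsubmx C = mx2 (B i i) (B i j) (B j i) (B j j).
  by apply: mx2P; rewrite !mxE /= -?s0 -?s1E.
have [|D] := cong_schur eC.
  rewrite ul; apply: GLR_of_det; last by rewrite det_mx2.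
  by have /mxOverP oB := evenmx_over eB; rewrite mxOver_mx2.
by rewrite ul => h; exists D; apply: cong_trans h.
Qed.

Lemma cong_split1 m (B : 'M[k]_(1 + m)) i : evenmx B -> B i i \in U ->
  exists D, cong B (block_mx (B i i)%:M 0 0 D).
Proof.
move=> eB uB; pose o0 : 'I_(1 + m) := lshift m 0; pose s := tperm o0 i.
have s0 : s o0 = i by rewrite tpermL.
pose C := \matrix_(a, b) B (s a) (s b).
have cC : cong B C := cong_perm B s.
have eC := evenmx_cong cC eB.
have ul : ulsubmx C = (B i i)%:M.
  by apply/matrixP => a b; rewrite !ord1 !mxE -/o0 s0.
have [|D] := cong_schur eC.
  rewrite ul; apply: GLR_of_det; last by rewrite det_scalar1.
  by apply: mxOver_scalar; rewrite ?rpred0 ?vunitR.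
by rewrite ul => h; exists D; apply: cong_trans h.
Qed.

(** * Splitting off binary blocks *)

Hypothesis n2 : 2 != 0 :> k.

Lemma vring_dvd_total (a b : k) :
  (exists2 t, t \in R & a = t * b) \/ (exists2 t, t \in R & b = t * a).
Proof.
have [->|a0] := eqVneq a 0; first by left; exists 0; rewrite ?rpred0 ?mul0r.
have [->|b0] := eqVneq b 0; first by right; exists 0; rewrite ?rpred0 ?mul0r.
have vq x y : x != 0 -> y != 0 -> v (x / y) = v x - v y.
  move=> x0 y0; have q0 : x / y != 0 by rewrite mulf_neq0 ?invr_eq0.
  have := Defs.valM hk q0 y0.
  by rewrite divfK //; lia.
have [ab|ab] := leP (v a) (v b); [right; exists (b / a)|left; exists (a / b)];
  rewrite ?divfK // inE /vge vq // subr_ge0 ?ab ?(ltW ab) orbT //.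
Qed.

Lemma mxOver_vmax_mull m n q (A : 'M[k]_(m, n)) (B : 'M[k]_(n, q)) :
  A \is a mxOver p -> B \is a mxOver R -> A *m B \is a mxOver p.
Proof.
move=> /mxOverP oA /mxOverP oB; apply/mxOverP => i j; rewrite mxE.
by apply: rpred_sum => l _; apply: vmaxMl.
Qed.

(** If all entries were in [p], then ['e_i1 / w] and ['e_i2 / w], with [w] a uniformizer, would lie
    in the dual and be independent modulo [p] in the quotient, which a cyclic module over a
    valuation ring does not allow. *)
Lemma cyclicmx_unit_entry m (B : 'M[k]_m) (i1 i2 : 'I_m) : i1 != i2 ->
  B \is a mxOver R -> cyclicmx B -> exists i j, B i j \in U.
Proof.
move=> i12 /mxOverP oB [x dx hx].
case: (boolP [exists i, exists j, B i j \in U]) => [/existsP[i /existsP[j h]]|].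
  by exists i, j.
rewrite negb_exists => /forallP h.
have hp i j : B i j \in p.
  have := h i; rewrite negb_exists => /forallP/(_ j).
  by have [->|] := vring_unit (oB i j).
have [w w0 vw] := val_uniformizer hk.
have wV0 : w^-1 != 0 by rewrite invr_eq0.
have vwV : v w^-1 = -1.
  have := Defs.valM hk w0 wV0; rewrite divff // val1 vw; lia.
have wV y : y \in p -> w^-1 * y \in R.
  rewrite !inE /vge mulf_eq0 invr_eq0 (negbTE w0) /=; case: eqVneq => //= y0.
  by rewrite (Defs.valM hk wV0 y0) vwV; lia.
have wN : w^-1 \notin R by rewrite inE /vge invr_eq0 (negbTE w0) vwV.
have dw i : dualv B (w^-1 *: 'e_i).
  by rewrite /dualv -scalemxAl -rowE; apply/mxOverP => a b; rewrite !mxE wV.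
(* Subtracting [t] times the second relation cancels [x] and leaves the non-integral [w^-1] in
   coordinate [j1]. *)
have key a b (j1 j2 : 'I_m) : j1 != j2 -> (w^-1 *: 'e_j1 - a *: x) \is a mxOver R ->
    (w^-1 *: 'e_j2 - b *: x) \is a mxOver R -> forall t, t \in R -> a = t * b -> False.
  move=> j12 h1 h2 t tR e; case/negP: wN.
  have : (w^-1 *: 'e_j1 - a *: x) - t *: (w^-1 *: 'e_j2 - b *: x) \is a mxOver R.
    by rewrite rpredB // mxOverZ.
  rewrite scalerBr !scalerA -e opprB addrA subrK => /mxOverP/(_ 0 j1).
  by rewrite !mxE !eqxx (negbTE j12) mulr1 mulr0 subr0.
have [a aR ha] := hx _ (dw i1); have [b bR hb] := hx _ (dw i2).
have [[t tR e]|[t tR e]] := vring_dvd_total a b; exfalso.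
  exact: (key _ _ _ _ i12 ha hb t tR e).
by rewrite eq_sym in i12; exact: (key _ _ _ _ i12 hb ha t tR e).
Qed.

Lemma vmax_notU x : x \in p -> x \in U -> False.
Proof. by move=> xp; rewrite vunitP xp andbF. Qed.

Lemma vunit_divl x y : x \in R -> y \in R -> x * y \in U -> x \in U.
Proof.
move=> xR yR xyU; have [//|xp] := vring_unit xR.
by case: (vmax_notU (vmaxMl xp yR) xyU).
Qed.

Lemma vunitN x : x \in U -> - x \in U.
Proof. by rewrite !vunitP !rpredN. Qed.

(** It suffices to find a principal 2 by 2 minor that is a unit. An off-diagonal unit in a row whose
    diagonal entry is in [p] gives one. If instead a diagonal entry is a unit, it is split off, and
    a unit entry of the complement, of rank at least two since [0 < m], completes the choice. *)
Lemma cong_binary_summand m (B : 'M[k]_(2 + m)) : (0 < m)%N -> evenmx B -> cyclicmx B ->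
  exists (P : 'M_2) D, \det P \in U /\ cong B (block_mx P 0 0 D).
Proof.
move=> m0 eB cB; have sB := evenmx_sym eB; have /mxOverP oB := evenmx_over eB.
have minor n (C : 'M[k]_(2 + n)) i j : evenmx C -> i != j ->
    C i i * C j j - C i j * C j i \in U ->
    exists (P : 'M_2) D, \det P \in U /\ cong C (block_mx P 0 0 D).
  move=> eC ij u; have [D cD] := cong_split2 eC ij u.
  by exists (mx2 (C i i) (C i j) (C j i) (C j j)), D; rewrite det_mx2.
have [i [j u]] : exists i j, B i j \in U.
  apply: (@cyclicmx_unit_entry _ _ (lshift m 0) (lshift m 1)) => //.
  by apply: evenmx_over.
have BC a b : B a b = B b a by rewrite -{1}sB mxE.
have [iU|ip] := vring_unit (oB i i); last first.
  have ij : i != j.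
    by apply: contraL ip => /eqP e; move: u; rewrite -e vunitP => /andP[].
  apply: (minor _ _ i j) => //.
  by rewrite addrC vunitD_vmax ?vmaxMl // vunitN // vunitM // BC.
have [D cD] := @cong_split1 m.+1 B i eB iU.
have eC := evenmx_cong cD eB.
have [_ eD] := (evenmx_block _ _).1 eC.
have cyD := cyclicmx_block (cyclicmx_cong cD cB).
have /mxOverP oD := evenmx_over eD.
have [a [b uD]] : exists a b, D a b \in U.
  have m1 : (1 < m.+1)%N by [].
  by apply: (@cyclicmx_unit_entry _ _ ord0 (Ordinal m1)) => //; apply: evenmx_over.
pose C : 'M[k]_(2 + m) := (block_mx (B i i)%:M 0 0 D : 'M_(1 + m.+1)).
have C00 : C (@lshift 1 m.+1 0) (@lshift 1 m.+1 0) = B i i.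
  by rewrite [LHS]block_mxEul mxE eqxx.
have C01 c : C (@lshift 1 m.+1 0) (@rshift 1 m.+1 c) = 0.
  by rewrite [LHS]block_mxEur mxE.
have C11 c d : C (@rshift 1 m.+1 c) (@rshift 1 m.+1 d) = D c d.
  by rewrite [LHS]block_mxEdr.
suff [P [D' [dP cP]]] :
    exists (P : 'M_2) D', \det P \in U /\ cong C (block_mx P 0 0 D').
  by exists P, D'; split=> //; apply: cong_trans cP.
have diag c : D c c \in U ->
    exists (P : 'M_2) D', \det P \in U /\ cong C (block_mx P 0 0 D').
  move=> uc; apply: (minor _ C (@lshift 1 m.+1 0) (@rshift 1 m.+1 c)) => //.
  by rewrite C00 C11 C01 mul0r subr0 vunitM.
have [/diag//|ap] := vring_unit (oD a a).
have ab : a != b by apply: contraL ap => /eqP e; move: uD; rewrite -e vunitP => /andP[].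
apply: (minor _ C (@rshift 1 m.+1 a) (@rshift 1 m.+1 b)) => //.
rewrite !C11 addrC vunitD_vmax ?vmaxMl // vunitN // vunitM //.
by rewrite -(evenmx_sym eD) mxE.
Qed.

(** Integrality of the form is read off here, although [qf] divides by 2. *)
Lemma qf_even m (B : 'M[k]_m) C x : B = C + C^T -> qf B x = (x *m C *m x^T) 0 0.
Proof.
move=> ->; rewrite /qf /bf mulmxDr mulmxDl mxE.
have -> : (x *m C^T *m x^T) 0 0 = (x *m C *m x^T) 0 0.
  by rewrite -[in RHS](trmxK (x *m C *m x^T)) [RHS]mxE !trmx_mul trmxK mulmxA.
by field.
Qed.

Lemma qf_over m (B : 'M[k]_m) x : evenmx B -> x \is a mxOver R -> qf B x \in R.
Proof.
move=> [C oC e] ox; rewrite (qf_even x e).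
by have /mxOverP -> // : x *m C *m x^T \is a mxOver R; rewrite !mxOverM ?mxOver_tr.
Qed.

Lemma qf_vmax m (B : 'M[k]_m) x : evenmx B -> x \is a mxOver p -> qf B x \in p.
Proof.
move=> [C oC e] ox; rewrite (qf_even x e).
have oxR : x \is a mxOver R by apply/mxOverP => i j; apply/vmaxR/(mxOverP ox).
have /mxOverP -> // : x *m C *m x^T \is a mxOver p.
by rewrite mxOver_vmax_mull ?mxOver_tr // mxOver_vmax_mull.
Qed.

Lemma bf_diag m (B : 'M[k]_m) x : bf B x x = 2 * qf B x.
Proof. by rewrite /qf mulrC divfK. Qed.

Lemma qfD m (B : 'M[k]_m) x t y : B^T = B ->
  qf B (x + t *: y) = qf B x + t * bf B x y + t ^+ 2 * qf B y.
Proof.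
move=> sB; rewrite /qf !bfDl !bfDr !bfZl !bfZr (bfC y x sB).
by field.
Qed.

Lemma qf_delta m (B : 'M[k]_m) j : qf B 'e_j = B j j / 2.
Proof. by rewrite /qf bf_delta2. Qed.

Definition hyp2 : 'M[k]_2 := mx2 0 1 1 0.

Lemma cong_hyp2 u c : u \in U -> c \in R -> cong (mx2 0 u u (2 * c)) hyp2.
Proof.
move=> uU cR; have u0 := vunit_neq0 uU; have uV := vunitV uU.
exists (mx2 1 0 (- c * (u^-1 * u^-1)) u^-1).
  apply: GLR_of_det.
    by rewrite mxOver_mx2 ?rpred1 ?rpred0 // rpredM ?rpredN ?rpredM.
  by rewrite det_mx2 mul1r mul0r subr0 vunitVU.
by rewrite tr_mx2 !mul_mx2 /hyp2; congr mx2; field.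
Qed.

(** For [N = e_i^T (z - e_i)] one has [N^2 = (z_i - 1) N], so [1 + N] has the inverse
    [1 - z_i^-1 N]. *)
Lemma GLR_replace_row m (z : 'rV[k]_m) i : z \is a mxOver R -> z 0 i \in U ->
  exists A, [/\ GLR A, row i A = z & forall j, j != i -> row j A = 'e_j].
Proof.
move=> oz uz; have z0 := vunit_neq0 uz.
pose N := delta_mx i 0 *m (z - 'e_i) : 'M[k]_m.
have oN : N \is a mxOver R.
  by rewrite mxOverM ?mxOver_delta // rpredB ?mxOver_delta.
have N2 : N *m N = (z 0 i - 1) *: N.
  rewrite /N mulmxA -(mulmxA (delta_mx i 0)) -colE.
  have -> : col i (z - 'e_i) = (z 0 i - 1)%:M.
    by apply/matrixP => a b; rewrite !ord1 !mxE !eqxx.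
  by rewrite mul_mx_scalar -scalemxAl.
exists (1%:M + N); split.
- split; first by rewrite rpredD ?mxOver_one.
  exists (1%:M - (z 0 i)^-1 *: N).
    by rewrite rpredB ?mxOver_one // mxOverZ ?vunitV.
  rewrite mulmxBr mulmx1 mulmxDl mul1mx -scalemxAr N2 scalerA.
  apply/eqP; rewrite subr_eq addrC; apply/eqP; rewrite addrC; congr (_ + _).
  rewrite -scalerDl -[LHS]scale1r; congr (_ *: _); by field.
- rewrite linearD /= rowE mulmx1 /N rowE mulmxA mul_delta_mx.
  have -> : delta_mx 0 0 = 1%:M :> 'M[k]_1.
    by apply/matrixP => a b; rewrite !ord1 !mxE.
  by rewrite mul1mx addrC subrK.
- move=> j ji; rewrite linearD /= rowE mulmx1 /N rowE mulmxA mul_delta_mx_0 //.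
  by rewrite mul0mx addr0.
Qed.

(** Hensel's lemma moves [x] along ['e_j] to an isotropic [z] with the same unit pairing modulo [p].
    Some basis vector other than ['e_j] can be exchanged for [z], and [z], ['e_j] then span a
    hyperbolic plane. *)
Lemma cong_split_hyp2 m (B : 'M[k]_(2 + m)) x j : evenmx B -> x \is a mxOver R ->
  qf B x \in p -> (x *m B) 0 j \in U -> exists D, cong B (block_mx hyp2 0 0 D).
Proof.
move=> eB ox qx ux; have sB := evenmx_sym eB; have oB := evenmx_over eB.
have oe l : ('e_l : 'rV[k]_(2 + m)) \is a mxOver R by exact: mxOver_delta.
have cR := qf_over eB (oe j); set c := qf B 'e_j in cR.
have Bjj : B j j = 2 * c by rewrite -bf_diag bf_delta2.
have qxN : - qf B x \in p by rewrite rpredN.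
have [t tp et] := hensel cR ux qxN.
pose z := x + t *: 'e_j.
have oz : z \is a mxOver R by rewrite rpredD // mxOverZ // vmaxR.
have qz : qf B z = 0.
  rewrite qfD // bf_delta -/c [t * _]mulrC [t ^+ 2 * _]mulrC -addrA.
  by rewrite [_ + c * _]addrC et subrr.
have uz : (z *m B) 0 j \in U.
  rewrite mulmxDl mxE vunitD_vmax // -scalemxAl -rowE !mxE vmaxMl //.
  exact: (mxOverP oB).
clearbody z.
(* Otherwise [z] is [z_j e_j] modulo [p]; isotropy forces [z_j c] into [p], and then the pairing of
   [z] with ['e_j], which is [2 c z_j] modulo [p], is not a unit. *)
have [i ij ui] : exists2 i, i != j & z 0 i \in U.
  case: (boolP [exists i, (i != j) && (z 0 i \in U)]) => [/existsP[i /andP[]]|].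
    by exists i.
  rewrite negb_exists => /forallP h; exfalso.
  pose w := z - z 0 j *: 'e_j.
  have ow : w \is a mxOver p.
    apply/mxOverP => a b; rewrite ord1 !mxE eqxx /=.
    have := h b; have [->|bj] /= := eqVneq b j; first by rewrite mulr1 subrr rpred0.
    rewrite mulr0 subr0 => nu; have [u|//] := vring_unit (mxOverP oz 0 b).
    by rewrite u in nu.
  have zjR : z 0 j \in R := mxOverP oz 0 j.
  have ez : z = w + z 0 j *: 'e_j by rewrite subrK.
  have wBj : (w *m B) 0 j \in p := mxOverP (mxOver_vmax_mull ow oB) 0 j.
  have e0 : (z 0 j) ^+ 2 * c \in p.
    have := qz; rewrite {1}ez qfD // bf_delta -/c => e.
    have -> : (z 0 j) ^+ 2 * c = - (qf B w + z 0 j * (w *m B) 0 j).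
      by apply/eqP; rewrite -addr_eq0 addrC; apply/eqP.
    by rewrite rpredN; apply: rpredD; [exact: qf_vmax|exact: vmaxMr].
  have zc : z 0 j * c \in p.
    have [|zp|cp] := vmax_prime _ cR e0; [by rewrite rpredX| |by rewrite vmaxMr].
    by move: zp; rewrite expr2 => /(vmax_prime zjR zjR)[] zp; rewrite vmaxMl.
  apply: vmax_notU uz; rewrite ez mulmxDl -scalemxAl -rowE mxE.
  by apply: rpredD => //; rewrite !mxE Bjj mulrCA vmaxMr ?vring_nat.
have [A [gA ri rj]] := GLR_replace_row oz ui.
pose C := A *m B *m A^T; have cC : cong B C by exists A.
have eC := evenmx_cong cC eB.
have Cii : C i i = 0 by rewrite congE ri bf_diag qz mulr0.
have Cij : C i j = (z *m B) 0 j by rewrite congE ri rj 1?eq_sym // bf_delta.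
have Cji : C j i = (z *m B) 0 j by rewrite -Cij -{1}(evenmx_sym eC) mxE.
have Cjj : C j j = 2 * c by rewrite congE rj 1?eq_sym // bf_delta2.
have [|D cD] := cong_split2 eC ij.
  by rewrite Cii Cij Cji mul0r sub0r vunitN // vunitM.
exists D; apply: cong_trans cC _; apply: cong_trans cD _.
rewrite Cii Cij Cji Cjj; apply: cong_block; last exact: cong_refl.
exact: cong_hyp2.
Qed.

(* The Gram matrix of [x^2 + x y + c y^2]. *)
Definition as2 c : 'M[k]_2 := mx2 2 1 1 (2 * c).

Lemma as2_det c : \det (as2 c) = 4 * c - 1.
Proof. by rewrite det_mx2; ring. Qed.

Lemma cong_as2_rootless c c' : rootless c -> rootless c' -> cong (as2 c) (as2 c').
Proof.
move=> rc rc'; have [b [bR bU ->]] := rootless_equiv rc rc'.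
exists (mx2 1 0 b (1 - 2 * b)).
  apply: GLR_of_det; first by rewrite mxOver_mx2 ?rpred1 ?rpred0 // vunitR.
  by rewrite det_mx2 mul1r mul0r subr0.
by rewrite tr_mx2 !mul_mx2 /as2; congr mx2; ring.
Qed.

(** A solution modulo [p] lifts in a variable whose partial derivative is a unit. If both partials
    were in [p], the unit discriminant would put [x] and [y] in [p]. *)
Lemma binary_rep_one a b c : a \in R -> b \in R -> c \in R ->
  b ^+ 2 - 4 * a * c \in U ->
  exists x y, [/\ x \in R, y \in R & a * x ^+ 2 + b * x * y + c * y ^+ 2 = 1].
Proof.
move=> aR bR cR dU.
have [x [y [xR yR vp]]] := binary_rep aR bR cR dU (rpred1 _).
have r2 := vring_nat 2.
have s1R : 2 * a * x + b * y \in R by rewrite rpredD ?rpredM.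
have s2R : b * x + 2 * c * y \in R by rewrite rpredD ?rpredM.
have rp : 1 - (a * x ^+ 2 + b * x * y + c * y ^+ 2) \in p by rewrite -opprB rpredN.
have [s1U|s1p] := vring_unit s1R.
  have [t tp e] := hensel aR s1U rp.
  exists (x + t), y; split=> //; first by rewrite rpredD // vmaxR.
  by rewrite -[RHS](subrK (a * x ^+ 2 + b * x * y + c * y ^+ 2)) -e; ring.
have [s2U|s2p] := vring_unit s2R.
  have [t tp e] := hensel cR s2U rp.
  exists x, (y + t); split=> //; first by rewrite rpredD // vmaxR.
  by rewrite -[RHS](subrK (a * x ^+ 2 + b * x * y + c * y ^+ 2)) -e; ring.
exfalso.
have nd : b ^+ 2 - 4 * a * c \notin p by move: dU; rewrite vunitP => /andP[].
have dR := vunitR dU.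
have xp : x \in p.
  have : (b ^+ 2 - 4 * a * c) * x \in p.
    have -> : (b ^+ 2 - 4 * a * c) * x =
      (b * x + 2 * c * y) * b - (2 * a * x + b * y) * (2 * c) by ring.
    by rewrite rpredB // vmaxMl // rpredM.
  by case/(vmax_prime dR xR) => // h; rewrite h in nd.
have yp : y \in p.
  have : (b ^+ 2 - 4 * a * c) * y \in p.
    have -> : (b ^+ 2 - 4 * a * c) * y =
      (2 * a * x + b * y) * b - (b * x + 2 * c * y) * (2 * a) by ring.
    by rewrite rpredB // vmaxMl // rpredM.
  by case/(vmax_prime dR yR) => // h; rewrite h in nd.
have : a * x ^+ 2 + b * x * y + c * y ^+ 2 \in p.
  by rewrite !rpredD // ?expr2 vmaxMr ?rpredM // vmaxMr.
by move=> /(rpredD rp); rewrite subrK vmax1.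
Qed.

(** A vector of value 1 is completed to a basis by a second vector that pairs to 1 with it. *)
Lemma cong_as2 (P : 'M[k]_2) : evenmx P -> \det P \in U ->
  exists c, [/\ c \in R, 4 * c - 1 \in U & cong P (as2 c)].
Proof.
move=> eP dP.
have [a [b [c [aR bR cR PE]]]] : exists a b c,
    [/\ a \in R, b \in R, c \in R & P = mx2 (2 * a) b b (2 * c)].
  case: eP => C /mxOverP oC ->; exists (C 0 0), (C 0 1 + C 1 0), (C 1 1).
  split=> //; first by rewrite rpredD.
  by apply: mx2P; rewrite !mxE //=; ring.
have r2 := vring_nat 2.
have dU : b ^+ 2 - 4 * a * c \in U.
  by move: (vunitN dP); rewrite PE det_mx2 => h; apply: mem_cast h _; ring.
have [x [y [xR yR e1]]] := binary_rep_one aR bR cR dU.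
(* The pairing of [(x, y)] with [(z, w)]. *)
pose be z w := 2 * a * x * z + b * (x * w + y * z) + 2 * c * y * w.
have [z0 [w0 [zR wR dl]]] : exists z w, [/\ z \in R, w \in R & x * w - y * z \in U].
  have [xU|xp] := vring_unit xR.
    by exists 0, 1; rewrite rpred0 rpred1 mulr1 mulr0 subr0.
  have [yU|yp] := vring_unit yR.
    by exists (-1), 0; rewrite rpred0 rpredN rpred1 mulrN1 mulr0 sub0r opprK.
  have : a * x ^+ 2 + b * x * y + c * y ^+ 2 \in p.
    by rewrite !rpredD // ?expr2 vmaxMr ?rpredM // vmaxMr.
  by rewrite e1 vmax1.
have beR : be z0 w0 \in R.
  by rewrite /be; do ![assumption | apply: rpredD | apply: rpredM].
have [z [w [z1R w1R d1U b1]]] : exists z w,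
    [/\ z \in R, w \in R, x * w - y * z \in U & be z w = 1].
  have [bU|bp] := vring_unit beR.
    have b0 := vunit_neq0 bU; have bV := vunitV bU.
    exists (z0 / be z0 w0), (w0 / be z0 w0); split; rewrite ?rpredM //.
      by rewrite !mulrA -mulrBl vunitM // vunitVU.
    by rewrite -[RHS](divff b0) {1 4}/be; ring.
  (* A unit pairing was normalised by scaling. A pairing in [p] forces 2 to be a unit, as the
     determinant is a unit; then a multiple of [(x, y)], whose self-pairing is 2, corrects it to
     1. *)
  have [u2|p2] := vring_unit r2; last first.
    exfalso; have : (x * w0 - y * z0) ^+ 2 * (b ^+ 2 - 4 * a * c) \in p.
      have -> : (x * w0 - y * z0) ^+ 2 * (b ^+ 2 - 4 * a * c) = be z0 w0 ^+ 2 -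
        2 * (2 * (a * x ^+ 2 + b * x * y + c * y ^+ 2) *
          (a * z0 ^+ 2 + b * z0 * w0 + c * w0 ^+ 2)) by rewrite /be; ring.
      apply: rpredB; first by rewrite expr2 vmaxMl.
      apply: vmaxMl => //; rewrite e1 mulr1.
      by do ![assumption | apply: rpredD | apply: rpredM | apply: rpredX].
    by move=> h; apply: (vmax_notU h); rewrite expr2 !vunitM.
  pose l := (1 - be z0 w0) * 2^-1.
  have lR : l \in R by rewrite rpredM ?vunitV // rpredB ?rpred1.
  exists (z0 + l * x), (w0 + l * y); split.
  - by rewrite rpredD // rpredM.
  - by rewrite rpredD // rpredM.
  - by have -> : x * (w0 + l * y) - y * (z0 + l * x) = x * w0 - y * z0 by ring.
  have -> : be (z0 + l * x) (w0 + l * y) = be z0 w0 +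
    2 * l * (a * x ^+ 2 + b * x * y + c * y ^+ 2) by rewrite /be; ring.
  by rewrite e1 mulr1 /l mulrC divfK // addrC subrK.
pose c' := a * z ^+ 2 + b * z * w + c * w ^+ 2.
have c'R : c' \in R.
  by rewrite /c'; do ![assumption | apply: rpredD | apply: rpredM | apply: rpredX].
have cP : cong P (as2 c').
  exists (mx2 x y z w).
    by apply: GLR_of_det; rewrite ?mxOver_mx2 // det_mx2.
  rewrite PE tr_mx2 !mul_mx2 /as2; congr mx2.
  - transitivity (2 * (a * x ^+ 2 + b * x * y + c * y ^+ 2)); last by ring.
    by rewrite e1 mulr1.
  - by rewrite -[LHS]b1 /be; ring.
  - by rewrite -[LHS]b1 /be; ring.
  - by rewrite /c'; ring.
exists c'; split=> //; rewrite -as2_det.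
by have [u uU ->] := cong_det cP; rewrite expr2 !vunitM.
Qed.

Definition row2 (a b : k) : 'rV[k]_2 := \row_i if i == 0 then a else b.

Lemma mul_row2 a b c : row2 a b *m as2 c = row2 (2 * a + b) (a + 2 * c * b).
Proof.
by apply/matrixP => i j; rewrite !ord1 !mxE sum2 !mxE;
  case: (ord2E j) => -> /=; ring.
Qed.

Lemma qf_row2 a b c : qf (as2 c) (row2 a b) = a ^+ 2 + a * b + c * b ^+ 2.
Proof. by rewrite /qf /bf mul_row2 !mxE sum2 !mxE /=; field. Qed.

(** As [as2 c] is unimodular, a unit among [a] and [b] already makes the vector pair to a unit with
    the lattice, which is what [cong_split_hyp2] requires. *)
Lemma as2_split_hyp2 m c (D : 'M[k]_m) a b y : evenmx D -> c \in R -> 4 * c - 1 \in U ->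
  a \in R -> b \in R -> y \is a mxOver R ->
  a ^+ 2 + a * b + c * b ^+ 2 + qf D y \in p ->
  [\/ a \in U, b \in U | exists j, (y *m D) 0 j \in U] ->
  exists D', cong (block_mx (as2 c) 0 0 D) (block_mx hyp2 0 0 D').
Proof.
move=> eD cR dU aR bR oy qp hu; have r2 := vring_nat 2.
have eC : evenmx (block_mx (as2 c) 0 0 D).
  apply/evenmx_block; split=> //; exists (mx2 1 1 0 c).
    by rewrite mxOver_mx2 ?rpred0 ?rpred1.
  by apply: mx2P; rewrite !mxE /=; ring.
have ox : row_mx (row2 a b) y \is a mxOver R.
  by rewrite mxOver_row oy andbT; apply/mxOverP => i j; rewrite mxE; case: ifP.
have xB : row_mx (row2 a b) y *m block_mx (as2 c) 0 0 D =
    row_mx (row2 (2 * a + b) (a + 2 * c * b)) (y *m D).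
  by rewrite mul_row_block !mulmx0 addr0 add0r mul_row2.
have qx : qf (block_mx (as2 c) 0 0 D) (row_mx (row2 a b) y) \in p.
  by rewrite qf_block qf_row2.
suff [j uj] : exists j, (row_mx (row2 (2 * a + b) (a + 2 * c * b)) (y *m D)) 0 j \in U.
  by apply: (@cong_split_hyp2 m _ (row_mx (row2 a b) y) j) => //; rewrite xB.
have s1R : 2 * a + b \in R by rewrite rpredD ?rpredM.
have s2R : a + 2 * c * b \in R by rewrite rpredD ?rpredM.
have [s1U|s1p] := vring_unit s1R.
  by exists (lshift m 0); rewrite row_mxEl mxE.
have [s2U|s2p] := vring_unit s2R.
  by exists (lshift m 1); rewrite row_mxEl mxE.
have ap : a * (4 * c - 1) \in p.
  have -> : a * (4 * c - 1) = (2 * a + b) * (2 * c) - (a + 2 * c * b) by ring.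
  by rewrite rpredB // vmaxMl // rpredM.
have bp : b * (4 * c - 1) \in p.
  have -> : b * (4 * c - 1) = (a + 2 * c * b) * 2 - (2 * a + b) by ring.
  by rewrite rpredB // vmaxMl.
case: hu => [aU|bU|[j uj]].
- by case: (vmax_notU ap (vunitM aU dU)).
- by case: (vmax_notU bp (vunitM bU dU)).
- by exists (rshift 2 j); rewrite row_mxEr.
Qed.

Lemma as2_even c : c \in R -> evenmx (as2 c).
Proof.
move=> cR; exists (mx2 1 1 0 c); first by rewrite mxOver_mx2 ?rpred0 ?rpred1.
by apply: mx2P; rewrite !mxE /=; ring.
Qed.

Lemma hyp2_even : evenmx hyp2.
Proof.
exists (mx2 0 1 0 0); first by rewrite mxOver_mx2 ?rpred0 ?rpred1.
by apply: mx2P; rewrite !mxE /=; ring.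
Qed.

Lemma hyp2_det : \det hyp2 = -1.
Proof. by rewrite det_mx2; ring. Qed.

Lemma hyp2_GLR : GLR hyp2.
Proof.
apply: GLR_of_det; first exact: evenmx_over hyp2_even.
by rewrite hyp2_det vunitN // vunit1.
Qed.

Lemma as2_GLR c : c \in R -> 4 * c - 1 \in U -> GLR (as2 c).
Proof.
by move=> cR dU; apply: GLR_of_det; rewrite ?as2_det // evenmx_over //; apply: as2_even.
Qed.

(** The binary summand represents [- qf D y] modulo [p], so the sum is isotropic modulo [p]; the
    coordinates [a], [b] cannot both be in [p] because [qf D y] is a unit. *)
Lemma as2_split_rep m c (D : 'M[k]_m) y : evenmx D -> c \in R -> 4 * c - 1 \in U ->
  y \is a mxOver R -> qf D y \in U ->
  exists D', cong (block_mx (as2 c) 0 0 D) (block_mx hyp2 0 0 D').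
Proof.
move=> eD cR dU oy qU; have qR := vunitR qU.
have dU' : 1 ^+ 2 - 4 * 1 * c \in U by apply: mem_cast (vunitN dU) _; ring.
have qN : - qf D y \in R by rewrite rpredN.
have [a [b [aR bR h]]] := binary_rep (rpred1 _) (rpred1 _) cR dU' qN.
have {}h : a ^+ 2 + a * b + c * b ^+ 2 + qf D y \in p by apply: mem_cast h _; ring.
apply: (as2_split_hyp2 eD cR dU aR bR oy h).
have [aU|ap] := vring_unit aR; first by constructor 1.
have [bU|bp] := vring_unit bR; first by constructor 2.
case: (vmax_notU _ qU).
have -> : qf D y = (a ^+ 2 + a * b + c * b ^+ 2 + qf D y) -
    (a * a + a * b + c * (b * b)).
  by ring.
apply: rpredB => //; apply: rpredD; first by apply: rpredD; apply: vmaxMl.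
by rewrite vmaxMr // vmaxMl.
Qed.

Lemma cong_as2_summand m (B : 'M[k]_(2 + m)) : (0 < m)%N -> evenmx B -> cyclicmx B ->
  exists c D, [/\ c \in R, 4 * c - 1 \in U, evenmx D, cyclicmx D &
    cong B (block_mx (as2 c) 0 0 D)].
Proof.
move=> m0 eB cB; have [P [D [dP cP]]] := cong_binary_summand m0 eB cB.
have [eP eD] := (evenmx_block _ _).1 (evenmx_cong cP eB).
have cD := cyclicmx_block (cyclicmx_cong cP cB).
have [c [cR dU cc]] := cong_as2 eP dP.
exists c, D; split=> //; apply: cong_trans cP _; apply: cong_block => //.
exact: cong_refl.
Qed.

Lemma evenmx1 (D : 'M[k]_1) : evenmx D -> exists2 M, M \in R & D = (2 * M)%:M.
Proof.
move=> [C /mxOverP oC ->]; exists (C 0 0) => //.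
by apply/matrixP => i j; rewrite !ord1 !mxE eqxx mulr1n mulr_natl.
Qed.

Lemma qf_scalar1 (M : k) (x : 'rV[k]_1) : qf (2 * M)%:M x = M * x 0 0 ^+ 2.
Proof. by rewrite /qf /bf mul_mx_scalar -scalemxAl !mxE big_ord1 !mxE; field. Qed.

(** * Normal forms *)

(** This is [2 (n + 1) + 1], written recursively so that the blocks of [nf] have matching types. *)
Fixpoint nfdim n : nat := if n is n'.+1 then (2 + nfdim n')%N else (2 + 1)%N.

Fixpoint nf n (T : 'M[k]_(2 + 1)) : 'M[k]_(nfdim n) :=
  if n is n'.+1 return 'M[k]_(nfdim n) then block_mx hyp2 0 0 (nf n' T) else T.

Definition tern (P : 'M[k]_2) (M : k) : 'M[k]_(2 + 1) := block_mx P 0 0 (2 * M)%:M.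

Lemma nf_cong n T T' : cong T T' -> cong (nf n T) (nf n T').
Proof.
by move=> h; elim: n => //= n IH; apply: cong_block => //; apply: cong_refl.
Qed.

Lemma nf_even n T : evenmx T -> evenmx (nf n T).
Proof.
by move=> h; elim: n => //= n IH; apply/evenmx_block; split=> //; apply: hyp2_even.
Qed.

Lemma nf_cyclic n T : cyclicmx T -> cyclicmx (nf n T).
Proof.
by move=> h; elim: n => //= n IH; apply: cyclicmx_block_unit => //; apply: hyp2_GLR.
Qed.

Lemma nf_det n T : \det (nf n T) = (-1) ^+ n * \det T.
Proof.
by elim: n => [|n IH] /=; rewrite ?mul1r // det_ublock hyp2_det IH exprS mulrA.
Qed.

Lemma tern_det P M : \det (tern P M) = \det P * (2 * M).
Proof. by rewrite det_ublock det_scalar1. Qed.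

Lemma tern_even P M : evenmx P -> M \in R -> evenmx (tern P M).
Proof.
move=> eP MR; apply/evenmx_block; split=> //.
exists M%:M; first by rewrite mxOver_scalar ?rpred0.
by apply/matrixP => i j; rewrite !ord1 !mxE eqxx !mulr1n mulr_natl.
Qed.

Lemma tern_cyclic P M : GLR P -> M != 0 -> cyclicmx (tern P M).
Proof.
move=> gP M0; apply: cyclicmx_block_unit => //.
exists (2 * M)^-1%:M.
  by rewrite /dualv -scalar_mxM mulVf ?mulf_neq0 // mxOver_one.
move=> y dy; exists ((y *m (2 * M)%:M) 0 0); first exact: (mxOverP dy).
suff -> : y - (y *m (2 * M)%:M) 0 0 *: (2 * M)^-1%:M = 0 by exact: mxOver_zero.
apply/matrixP => i j; rewrite !ord1 mul_mx_scalar !mxE eqxx mulr1n.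
by rewrite [2 * M * _]mulrC mulfK ?mulf_neq0 // subrr.
Qed.

Lemma tern_scale P M w : w \in U -> cong (tern P M) (tern P (w ^+ 2 * M)).
Proof.
move=> wU; apply: cong_block; first exact: cong_refl.
exists w%:M.
  apply: GLR_of_det; rewrite ?det_scalar1 // mxOver_scalar ?rpred0 //.
  exact: vunitR.
by rewrite tr_scalar_mx -!scalar_mxM; congr (_%:M); ring.
Qed.

Lemma nf_exists c0 n (B : 'M[k]_(nfdim n)) : rootless c0 -> evenmx B -> cyclicmx B ->
  exists M, cong B (nf n (tern hyp2 M)) \/
    M \in p /\ cong B (nf n (tern (as2 c0) M)).
Proof.
move=> rc0; elim: n B => [|n IH] /= B eB cB.
  have [c [D [cR dU eD cD cP]]] := cong_as2_summand (isT : (0 < 1)%N) eB cB.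
  have hyp : (exists D', cong (block_mx (as2 c) 0 0 D) (block_mx hyp2 0 0 D')) ->
    exists M, cong B (tern hyp2 M) \/ M \in p /\ cong B (tern (as2 c0) M).
    move=> [D' cD']; have cBD := cong_trans cP cD'.
    have [_ /evenmx1[M MR eM]] := (evenmx_block _ _).1 (evenmx_cong cBD eB).
    by exists M; left; rewrite /tern -eM.
  have [M MR eM] := evenmx1 eD.
  have [MU|Mp] := vring_unit MR.
    apply/hyp/(@as2_split_rep _ _ _ 1%:M) => //; first exact: mxOver_one.
    by rewrite eM qf_scalar1 mxE eqxx expr1n mulr1.
  (* A root [t] modulo [p] makes [(t, 1, 0)] isotropic modulo [p]. *)
  have [[t tR tp]|nt] := pselect (exists2 t, t \in R & t ^+ 2 + t + c \in p).
    apply/hyp/(@as2_split_hyp2 _ _ _ t 1 0); rewrite ?rpred1 ?mxOver_zero //.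
      by rewrite eM qf_scalar1 mxE expr0n mulr0 addr0 expr1n !mulr1.
    by constructor 2; apply: vunit1.
  have rc : rootless c.
    by split=> // t tR; apply/negP => tp; case: nt; exists t.
  exists M; right; split=> //; apply: cong_trans cP _; rewrite /tern -eM.
  by apply: cong_block; [exact: cong_as2_rootless|exact: cong_refl].
have n0 : (0 < nfdim n)%N by case: (n).
have n1 : (1 < nfdim n)%N by case: (n).
have [c [D [cR dU eD cD cP]]] := cong_as2_summand n0 eB cB.
(* The complement has rank at least three, hence a unit entry. Either ['e_i] has a unit value, or it
   is isotropic modulo [p] and pairs to a unit with ['e_j]; a hyperbolic plane splits off in both
   cases. *)
have [i [j uij]] : exists i j, D i j \in U.
  apply: (@cyclicmx_unit_entry _ _ (Ordinal n0) (Ordinal n1)) => //.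
  by apply: evenmx_over.
have oe : ('e_i : 'rV[k]_(nfdim n)) \is a mxOver R by exact: mxOver_delta.
have [D' cD'] : exists D', cong (block_mx (as2 c) 0 0 D) (block_mx hyp2 0 0 D').
  have [qU|qp] := vring_unit (qf_over eD oe).
    exact: (as2_split_rep eD cR dU oe qU).
  apply: (as2_split_hyp2 eD cR dU (rpred0 _) (rpred0 _) oe).
    by rewrite expr0n !mulr0 !add0r.
  by constructor 3; exists j; rewrite -bf_delta bf_delta2.
have cBD := cong_trans cP cD'.
have [_ eD'] := (evenmx_block _ _).1 (evenmx_cong cBD eB).
have cyD' := cyclicmx_block (cyclicmx_cong cBD cB).
have [M hM] := IH _ eD' cyD'.
by exists M; case: hM => [h|[Mp h]]; [left|right; split=> //];
  apply: cong_trans cBD _; apply: cong_block => //; apply: cong_refl.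
Qed.

(** The determinant fixes the coefficient [M] up to the square of a unit, which [tern_scale]
    absorbs; the factor [1 - 4 c0] is minus the determinant of [as2 c0]. *)
Lemma nf_classify c0 n (B : 'M[k]_(nfdim n)) N u :
  rootless c0 -> evenmx B -> cyclicmx B -> u \in U ->
  (-1) ^+ n.+1 * \det B = u ^+ 2 * (2 * N) ->
  cong B (nf n (tern hyp2 N)) \/
  N \in p /\ cong B (nf n (tern (as2 c0) (N / (1 - 4 * c0)))).
Proof.
move=> rc0 eB cB uU eN; have dU := rootless_disc rc0.
have d0 := vunit_neq0 dU.
have [M hM] := nf_exists rc0 eB cB.
have scale P : cong B (nf n (tern P M)) -> exists2 w, w \in U &
    (- \det P) * M = w ^+ 2 * N /\
    forall M', M = w ^+ 2 * M' -> cong B (nf n (tern P M')).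
  move=> h; have [w wU e] := cong_det h; exists (w * u); first exact: vunitM.
  split=> [|M' eM].
    have s0 : (-1) ^+ n.+1 != 0 :> k by rewrite signr_eq0.
    apply: (mulfI n2); apply: (mulfI s0).
    move: e; rewrite nf_det tern_det => e.
    have -> : (-1) ^+ n.+1 * (2 * (- \det P * M)) = (-1) ^+ n * (\det P * (2 * M)).
      by rewrite exprS; ring.
    rewrite e.
    have -> : 2 * ((w * u) ^+ 2 * N) = w ^+ 2 * (u ^+ 2 * (2 * N)) by ring.
    rewrite -eN.
    have -> : (-1) ^+ n.+1 * (w ^+ 2 * ((-1) ^+ n.+1 * \det B)) =
       w ^+ 2 * \det B * ((-1) ^+ n.+1 * (-1) ^+ n.+1) by ring.
    by rewrite -expr2 sqrr_sign mulr1.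
  apply: cong_trans h _; apply: nf_cong.
  have wuU : w * u \in U by exact: vunitM.
  have -> : M' = (w * u)^-1 ^+ 2 * M.
    by rewrite eM mulrA -exprMn mulVf ?expr1n ?mul1r // vunit_neq0.
  by apply: tern_scale; apply: vunitVU.
case: hM => [h|[Mp h]]; have [w wU [e hw]] := scale _ h; [left|right].
  by apply: hw; rewrite -e hyp2_det opprK mul1r.
have w0 := vunit_neq0 wU.
have e' : (1 - 4 * c0) * M = w ^+ 2 * N by rewrite -e as2_det opprB.
split; last by apply: hw; rewrite mulrA -e' mulrC mulKf.
have -> : N = (w^-1 ^+ 2 * (1 - 4 * c0)) * M.
  by rewrite -mulrA e' mulrA -exprMn mulVf // expr1n mul1r.
by apply: vmaxMr => //; rewrite rpredM ?rpredX ?vunitV // vunitR.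
Qed.

(** * The Eichler invariant of the normal forms *)

Definition eichmx m (B : 'M[k]_m) N : Prop := exists2 x, dualv B x & 4 * N * qf B x = 1.

Lemma eichmx_cong m (B C : 'M[k]_m) N : cong B C -> eichmx B N -> eichmx C N.
Proof.
move=> [A gA ->] [x dx e]; have [A' [gA' e1 e2]] := GLR_inv gA.
exists (x *m A'); first by apply/dualv_cong; rewrite // -mulmxA e2 mulmx1.
by rewrite /qf bf_cong -mulmxA e2 mulmx1.
Qed.

Lemma eichmx_block m1 m2 (P : 'M[k]_m1) (D : 'M[k]_m2) N :
  eichmx D N -> eichmx (block_mx P 0 0 D) N.
Proof.
move=> [x dx e]; exists (row_mx 0 x).
  by apply/dualv_block; split=> //; rewrite /dualv mul0mx mxOver_zero.
by rewrite qf_block {1}/qf /bf !mul0mx mxE mul0r add0r.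
Qed.

(** The dual vector with last coordinate [1 / (2 N)] and zeros elsewhere has value [1 / (4 N)]. *)
Lemma eichmx_nf n P N : N != 0 -> eichmx (nf n (tern P N)) N.
Proof.
move=> N0; elim: n => [|n IH] /=; apply: eichmx_block => //.
exists (2 * N)^-1%:M.
  by rewrite /dualv -scalar_mxM mulVf ?mulf_neq0 // mxOver_one.
by rewrite qf_scalar1 mxE eqxx mulr1n; field; rewrite ?n2 ?N0.
Qed.

(* For [N] in the maximal ideal, integral summands change [4 N Q(x)] only      *)
(* modulo [4 p], so this weakening of [eichmx] descends to complements of      *)
(* unimodular blocks.                                                          *)
Definition weichmx m (B : 'M[k]_m) N : Prop :=
  exists x s, [/\ dualv B x, s \in p & 4 * N * qf B x = 1 + 4 * s].

Lemma weichmx_block m1 m2 (P : 'M[k]_m1) (D : 'M[k]_m2) N : evenmx P -> GLR P ->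
  N \in p -> weichmx (block_mx P 0 0 D) N -> weichmx D N.
Proof.
move=> eP gP Np [x [s [dx sp e]]]; move: dx e; rewrite -(hsubmxK x).
move=> /dualv_block[dl dr]; rewrite qf_block => e.
exists (rsubmx x), (s - N * qf P (lsubmx x)); split=> //.
  apply: rpredB => //; apply: vmaxMl => //; apply: qf_over => //.
  by apply: GLR_dualv dl.
by rewrite mulrBr addrA -e; ring.
Qed.

(** This is an instance of [R] being integrally closed. *)
Lemma as_integral t : t ^+ 2 + t \in R -> t \in R.
Proof.
move=> h; have [//|tN] := boolP (t \in R).
have t0 : t != 0 by apply: contraNneq tN => ->; exact: rpred0.
have tV0 : t^-1 != 0 by rewrite invr_eq0.
have tp : t^-1 \in p.
  move: tN; rewrite !inE /vge invr_eq0 (negbTE t0) /=.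
  have := Defs.valM hk t0 tV0; rewrite divff // val1; lia.
have uU := vunitD_vmax vunit1 tp.
have u0 := vunit_neq0 uU.
case/negP: (tN).
have -> : t = (t ^+ 2 + t) * (1 + t^-1)^-1 * t^-1.
  have t10 : t + 1 != 0.
    by have -> : t + 1 = (1 + t^-1) * t by [field]; exact: mulf_neq0.
  by field; rewrite t0 t10.
apply: rpredM; last exact: vmaxR.
by apply: rpredM => //; apply: vunitV.
Qed.

(** Otherwise [t = (a^-1 - 1) / 2] satisfies [t^2 + t = - (c + s) / (1 + 4 s)]. So [t] is integral,
    and it is a root of [t^2 + t + c] modulo [p]. *)
Lemma rootless_nonsquare c a s : rootless c -> a \in R -> s \in p ->
  (1 - 4 * c) * a ^+ 2 = 1 + 4 * s -> False.
Proof.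
move=> rc aR sp e; have [cR nc] := rc; have dU := rootless_disc rc.
have dR := vunitR dU.
have sU : 1 + 4 * s \in U by rewrite vunitD_vmax ?vunit1 // vmaxMr // vring_nat.
have aU : a \in U.
  by apply: (@vunit_divl a ((1 - 4 * c) * a)); rewrite ?rpredM // mulrCA -expr2 e.
have a0 := vunit_neq0 aU; have s0 := vunit_neq0 sU.
have n4 : 4 != 0 :> k by have -> : 4 = 2 * 2 :> k by [ring]; rewrite mulf_neq0.
pose t := (a^-1 - 1) / 2.
have sR := vmaxR sp.
have et : t ^+ 2 + t = - (c + s) * (1 + 4 * s)^-1.
  apply: (mulIf s0); rewrite mulfVK //.
  have -> : (t ^+ 2 + t) * (1 + 4 * s) = ((1 - 4 * c) - (1 + 4 * s)) / 4.
    rewrite -e /t; by field; rewrite ?a0 ?n2 ?n4.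
  by field.
have tR : t \in R by apply: as_integral; rewrite et rpredM ?vunitV // rpredN rpredD.
case/negP: (nc _ tR).
have -> : t ^+ 2 + t + c = s * ((4 * c - 1) * (1 + 4 * s)^-1) by rewrite et; field.
by apply: vmaxMl => //; rewrite rpredM ?vunitV // -opprB rpredN.
Qed.

(** After the unimodular blocks are removed, a dual vector of [<M>] with [M = N / (1 - 4 c0)] has
    value [a^2 / (4 M)] for some [a] in [R], whence [(1 - 4 c0) a^2 = 1 + 4 s]. *)
Lemma weichmx_as2 c0 n N : rootless c0 -> N != 0 -> N \in p ->
  ~ weichmx (nf n (tern (as2 c0) (N / (1 - 4 * c0)))) N.
Proof.
move=> rc0 N0 Np; have [cR _] := rc0; have dU := rootless_disc rc0.
have d0 := vunit_neq0 dU.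
elim: n => [|n IH] /=; last by move=> /(weichmx_block hyp2_even hyp2_GLR Np).
have dU' : 4 * c0 - 1 \in U by rewrite -opprB vunitN.
move=> /(weichmx_block (as2_even cR) (as2_GLR cR dU') Np)[x [s [dx sp]]].
rewrite qf_scalar1 => e.
apply: (@rootless_nonsquare c0 ((x *m (2 * (N / (1 - 4 * c0)))%:M) 0 0) s) => //.
  exact: (mxOverP dx).
by rewrite -e mul_mx_scalar mxE; field.
Qed.

Lemma eichmx_as2 c0 n N : rootless c0 -> N != 0 -> N \in p ->
  ~ eichmx (nf n (tern (as2 c0) (N / (1 - 4 * c0)))) N.
Proof.
move=> rc0 N0 Np [x dx e]; apply: (weichmx_as2 rc0 N0 Np (n := n)).
by exists x, 0; split=> //; rewrite ?rpred0 // e mulr0 addr0.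
Qed.

(** * Lattices in coordinates *)

Section Coordinates.
Variables (L : lattice v) (m : nat) (X : m.-tuple (lat_space L)).
Hypotheses (rkL : lat_rank L = m) (bX : lat_basis X).

Definition lvec (a : 'rV[k]_m) : lat_space L := \sum_(i < m) a 0 i *: X`_i.
Definition lcoord (x : lat_space L) : 'rV[k]_m := \row_i coord X i x.
Definition lgram : 'M[k]_m := \matrix_(i, j) lat_pair (tnth X i) (tnth X j).

Lemma lcoordK : cancel lcoord lvec.
Proof.
move=> x; rewrite /lvec; under eq_bigr do rewrite mxE.
rewrite -coord_span //.
suff -> : <<X>>%VS = fullv by exact: memvf.
apply/eqP; rewrite eqEdim subvf /= -/(lat_rank L) rkL.
by move: bX.1; rewrite /free => /eqP ->; rewrite size_tuple.
Qed.

Lemma lvecK : cancel lvec lcoord.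
Proof. by move=> a; apply/rowP => i; rewrite mxE coord_sum_free //; case: bX. Qed.

Lemma RspanP (V : vectType k) (Y : m.-tuple V) x : Rspan v Y x <->
  exists2 a : 'rV[k]_m, a \is a mxOver R & x = \sum_(i < m) a 0 i *: Y`_i.
Proof.
case: Y => s sz /=; move/eqP: sz => sz; case: m / sz.
split=> [[a aR ->]|[a /mxOverP aR ->]].
  exists (\row_i a i); first by apply/mxOverP => i j; rewrite mxE.
  by apply: eq_bigr => i _; rewrite mxE.
by exists (fun i => a 0 i).
Qed.

Lemma in_lat_lvec a : in_lat (lvec a) <-> a \is a mxOver R.
Proof.
split=> [/(bX.2 _).1 /RspanP[b ob e]|oa]; last by apply/(bX.2 _).2/RspanP; exists a.
by rewrite -(lvecK a) e -/(lvec b) lvecK.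
Qed.

Lemma lat_pairC (x y : lat_space L) : lat_pair x y = lat_pair y x.
Proof. by rewrite /lat_pair /polar [x + y]addrC addrAC. Qed.

Lemma lat_pairDl (x y z : lat_space L) :
  lat_pair (x + y) z = lat_pair x z + lat_pair y z.
Proof. by have := @polar_linear _ (lat_space L) 1 x y z; rewrite scale1r mul1r. Qed.

Lemma lat_pair0l (z : lat_space L) : lat_pair 0 z = 0.
Proof.
by apply: (addrI (lat_pair 0 z)); rewrite -lat_pairDl !addr0.
Qed.

Lemma lat_pairZl a (x z : lat_space L) : lat_pair (a *: x) z = a * lat_pair x z.
Proof.
have : lat_pair (a *: x + 0) z = a * lat_pair x z + lat_pair 0 z by exact: polar_linear.
by rewrite addr0 lat_pair0l addr0.
Qed.

Lemma lat_pair_suml (F : 'I_m -> lat_space L) z :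
  lat_pair (\sum_i F i) z = \sum_i lat_pair (F i) z.
Proof.
exact: (big_morph (fun x => lat_pair x z) (fun x y => lat_pairDl x y z) (lat_pair0l z)).
Qed.

Lemma lat_pair_lvec a b : lat_pair (lvec a) (lvec b) = bf lgram a b.
Proof.
rewrite lat_pair_suml /bf mxE.
under eq_bigr => i _ do rewrite lat_pairZl lat_pairC lat_pair_suml big_distrr /=.
rewrite exchange_big /=; apply: eq_bigr => j _.
rewrite !mxE big_distrl /=; apply: eq_bigr => i _.
by rewrite !mxE !(tnth_nth 0) lat_pairZl lat_pairC -mulrA; congr (_ * _); rewrite mulrC.
Qed.

Lemma lat_form_lvec a : lat_form (lvec a) = qf lgram a.
Proof.
rewrite /qf -lat_pair_lvec; set x := lvec a.
have -> : lat_pair x x = 2 * lat_form x.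
  rewrite /lat_pair /polar -mulr2n -scaler_nat.
  have -> : lat_form (2%:R *: x) = 2 ^+ 2 * lat_form x.
    by exact: (@qformZ _ (lat_space L)).
  by ring.
by field.
Qed.

Lemma lgram_sym : lgram^T = lgram.
Proof. by apply/matrixP => i j; rewrite !mxE lat_pairC. Qed.

Lemma in_dual_lvec a : in_dual (lvec a) <-> dualv lgram a.
Proof.
split=> [h|/mxOverP h y].
  apply/mxOverP => i j; rewrite ord1 -bf_delta -lat_pair_lvec; apply: h.
  by apply/in_lat_lvec; exact: mxOver_delta.
rewrite -(lcoordK y) => /in_lat_lvec /mxOverP oy.
rewrite lat_pair_lvec /bf mxE; apply: rpred_sum => i _.
by rewrite rpredM // mxE.
Qed.

Lemma lvec_delta i : lvec 'e_i = tnth X i.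
Proof.
rewrite /lvec (bigD1 i) //= mxE !eqxx scale1r big1 ?addr0 ?(tnth_nth 0) //.
by move=> j ji; rewrite mxE (negbTE ji) andbF scale0r.
Qed.

Lemma lgram_even : integral_lattice L -> evenmx lgram.
Proof.
move=> iL; have Xi i : in_lat (tnth X i).
  by rewrite -lvec_delta; apply/in_lat_lvec; exact: mxOver_delta.
have aD (x y : lat_space L) : in_lat x -> in_lat y -> in_lat (x + y).
  rewrite -(lcoordK x) -(lcoordK y) => /in_lat_lvec ox /in_lat_lvec oy.
  have -> : lvec (lcoord x) + lvec (lcoord y) = lvec (lcoord x + lcoord y).
    by rewrite /lvec -big_split; apply: eq_bigr => i _; rewrite /= [in RHS]mxE scalerDl.
  by apply/in_lat_lvec; rewrite rpredD.
have pR i j : lgram i j \in R.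
  by rewrite mxE /lat_pair /polar !rpredB //; apply: iL => //; apply: aD.
(* The upper triangular matrix of the quadratic form. *)
exists (\matrix_(i, j) if i == j then lat_form (tnth X i)
                       else if (i < j)%N then lgram i j else 0).
  apply/mxOverP => i j; rewrite mxE; case: ifP => _; first exact: iL.
  by case: ifP => _; rewrite ?rpred0.
apply/matrixP => i j; rewrite [RHS]mxE [X in _ = _ + X]mxE.
rewrite [X in _ = X + _]mxE [X in _ = _ + X]mxE.
rewrite [j == i]eq_sym; have [->|ij] := eqVneq i j.
  by rewrite -lvec_delta lat_form_lvec qf_delta; field.
have [lt|gt|e] := ltngtP i j; last by case/eqP: ij; apply: val_inj.
  by rewrite addr0.
by rewrite add0r -{1}lgram_sym mxE.
Qed.

Lemma lgram_cyclic : dual_quotient_cyclic L <-> cyclicmx lgram.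
Proof.
have lB (x y : 'rV[k]_m) a : lvec x - a *: lvec y = lvec (x - a *: y).
  rewrite /lvec scaler_sumr -sumrB; apply: eq_bigr => i _.
  by rewrite !mxE scalerBl scalerA.
split=> [[x dx hx]|[x dx hx]].
  exists (lcoord x); first by apply/in_dual_lvec; rewrite lcoordK.
  move=> y /in_dual_lvec/hx[a aR h]; exists a => //.
  by apply/in_lat_lvec; rewrite -lB lcoordK.
exists (lvec x); first exact/in_dual_lvec.
move=> y; rewrite -(lcoordK y) => /in_dual_lvec/hx[a aR h].
by exists a => //; rewrite lB; apply/in_lat_lvec.
Qed.

Lemma eichler_lgram N : eichler L N = if `[< eichmx lgram N >] then 1 else -1.
Proof.
rewrite /eichler; congr (if _ then _ else _); apply: asbool_equiv_eq.
split=> [[x dx e]|[x dx e]].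
  exists (lcoord x); first by apply/in_dual_lvec; rewrite lcoordK.
  by rewrite -lat_form_lvec lcoordK.
by exists (lvec x); [apply/in_dual_lvec|rewrite lat_form_lvec].
Qed.

Lemma signed_gram_detE : signed_gram_det X = (-1) ^+ m./2 * \det lgram.
Proof. by []. Qed.

End Coordinates.

(** The tuple length in [has_sdet] is [lat_rank L] itself; this replaces it by any equal
    expression. *)
Lemma has_sdetE (L : lattice v) m d : lat_rank L = m ->
  has_sdet L d <-> exists X : m.-tuple (lat_space L), lat_basis X /\
    exists2 u : k, u \in U & signed_gram_det X = u ^+ 2 * d.
Proof. by move=> e; case: m / e. Qed.

Lemma isometric_of_cong (L L' : lattice v) m (X : m.-tuple (lat_space L))
    (X' : m.-tuple (lat_space L')) : lat_rank L = m -> lat_rank L' = m ->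
  lat_basis X -> lat_basis X' -> cong (lgram X') (lgram X) -> isometric L L'.
Proof.
move=> rk rk' bX bX' [A gA e]; have [A' [gA' e1 e2]] := GLR_inv gA.
pose f x := lvec X' (lcoord X x *m A).
have lin_f : linear f.
  move=> a x y; rewrite /f.
  have -> : lcoord X (a *: x + y) = a *: lcoord X x + lcoord X y.
    by apply/rowP => i; rewrite !mxE linearP.
  rewrite mulmxDl -scalemxAl /lvec scaler_sumr -big_split; apply: eq_bigr => i _ /=.
  by rewrite [X in X *: _ = _]mxE [X in (X + _) *: _ = _]mxE scalerDl scalerA.
pose F : {linear lat_space L -> lat_space L'} :=
  HB.pack f (GRing.isLinear.Build _ _ _ _ f lin_f).
exists F; split.
- exists (fun y => lvec X (lcoord X' y *m A')) => x /=.
    by rewrite /f (lvecK bX') -mulmxA e1 mulmx1 (lcoordK rk bX).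
  by rewrite /f (lvecK bX) -mulmxA e2 mulmx1 (lcoordK rk' bX').
- move=> x /=; rewrite /f lat_form_lvec -[x in RHS](lcoordK rk bX) lat_form_lvec.
  by rewrite e /qf bf_cong.
- move=> x /=; rewrite -[x in X in _ <-> X](lcoordK rk bX) /f.
  rewrite (in_lat_lvec bX') (in_lat_lvec bX).
  split=> h; last by rewrite mxOverM // GLR_over.
  by rewrite -[lcoord X x]mulmx1 -e1 mulmxA mxOverM // GLR_over.
Qed.

(** * The lattice with a given Gram matrix *)

Section MatrixLattice.
Variables (m : nat) (B : 'M[k]_m).
Hypotheses (sB : B^T = B) (dB : \det B != 0).

Lemma polar_qf x y : polar (qf B) x y = bf B x y.
Proof. by rewrite /polar -[y in x + y]scale1r qfD // expr1n !mul1r; ring. Qed.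

Lemma mx_formZ a (x : 'rV[k]_m) : qf B (a *: x) = a ^+ 2 * qf B x.
Proof. by rewrite /qf bfZl bfZr; field. Qed.

Lemma mx_polar_linear a (x y z : 'rV[k]_m) :
  polar (qf B) (a *: x + y) z = a * polar (qf B) x z + polar (qf B) y z.
Proof. by rewrite !polar_qf bfDl bfZl. Qed.

Lemma mx_regular (x : 'rV[k]_m) : (forall y, polar (qf B) x y = 0) -> x = 0.
Proof.
move=> h; apply/eqP; apply: contraNT dB => x0; apply/det0P; exists x => //.
by apply/rowP => j; rewrite -bf_delta -polar_qf h mxE.
Qed.

Definition mxSpace : quadSpace k := QuadSpace mx_formZ mx_polar_linear mx_regular.

Definition mxBasis : m.-tuple 'rV[k]_m := [tuple 'e_i | i < m].

Lemma mxBasis_sum (a : 'rV[k]_m) : \sum_(i < m) a 0 i *: mxBasis`_i = a.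
Proof.
rewrite [RHS]row_sum_delta; apply: eq_bigr => i _.
by rewrite -tnth_nth tnth_mktuple.
Qed.

Lemma mxLattice_fg : exists s : seq mxSpace,
  (forall x, x \is a mxOver R <-> Rspan v s x) /\ <<s>>%VS = fullv.
Proof.
exists mxBasis; split=> [x|].
  split=> [ox|/RspanP[a oa ->]]; last by rewrite mxBasis_sum.
  by apply/RspanP; exists x; rewrite ?mxBasis_sum.
apply/eqP; rewrite eqEsubv subvf /=; apply/subvP => x _.
rewrite -(mxBasis_sum x); apply: memv_suml => i _; apply: memvZ; apply: memv_span.
by rewrite mem_nth // size_tuple.
Qed.

Definition mxLattice : lattice v := Lattice mxLattice_fg.

Lemma mxLattice_rank : lat_rank mxLattice = m.
Proof. by rewrite /lat_rank dimvf /= /dim /= mul1n. Qed.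

Lemma mxLattice_basis : @lat_basis k v mxLattice m mxBasis.
Proof.
split=> [|x].
  apply/freeP => a; rewrite -[RHS]/(0 : 'rV[k]_m) => e i.
  have : \sum_(i < m) (\row_j a j) 0 i *: mxBasis`_i = 0 :> 'rV[k]_m.
    by rewrite -[RHS]e; apply: eq_bigr => j _; rewrite mxE.
  by rewrite mxBasis_sum => /rowP/(_ i); rewrite !mxE.
split=> [ox|/RspanP[a oa ->]]; last by rewrite /= mxBasis_sum.
by apply/RspanP; exists x; rewrite ?mxBasis_sum.
Qed.

Lemma mxLattice_gram : @lgram mxLattice m mxBasis = B.
Proof.
apply/matrixP => i j; rewrite mxE !tnth_mktuple -bf_delta2.
exact: polar_qf.
Qed.

End MatrixLattice.

(** * The classification *)

Lemma nfdimE n : nfdim n = (2 * n.+1 + 1)%N.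
Proof. by elim: n => //= n ->; lia. Qed.

Lemma lattice_classified_by_matrix n (B : 'M[k]_(nfdim n)) N (e : int) :
  evenmx B -> cyclicmx B -> N != 0 -> (-1) ^+ n.+1 * \det B = 2 * N ->
  (if `[< eichmx B N >] then 1 else -1) = e ->
  (forall C u, evenmx C -> cyclicmx C -> u \in U ->
    (-1) ^+ n.+1 * \det C = u ^+ 2 * (2 * N) ->
    (if `[< eichmx C N >] then 1 else -1) = e -> cong C B) ->
  exists L : lattice v,
    [/\ special L, lat_rank L = (2 * n.+1 + 1)%N, has_sdet L (2 * N)
      & eichler L N = e] /\
    forall L' : lattice v,
      [/\ special L', lat_rank L' = (2 * n.+1 + 1)%N, has_sdet L' (2 * N)
        & eichler L' N = e] ->
      isometric L L'.
Proof.
move=> eB cB N0 dB eE uniq; have sB := evenmx_sym eB.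
have B0 : \det B != 0.
  have : 2 * N != 0 by rewrite mulf_neq0.
  by rewrite -dB mulf_eq0 negb_or => /andP[].
have hf : (nfdim n)./2 = n.+1 by rewrite nfdimE; lia.
pose L := mxLattice sB B0; have rk : lat_rank L = nfdim n := mxLattice_rank sB B0.
have bX : @lat_basis k v L _ (mxBasis _) := mxLattice_basis sB B0.
have gX : @lgram L _ (mxBasis _) = B := mxLattice_gram sB B0.
exists L; split=> [|L' [[iL' _ cL'] rk' sL' eL']].
  split; last by rewrite (eichler_lgram rk bX) gX.
  - split.
    + move=> x; rewrite -(lcoordK rk bX x) => /(in_lat_lvec bX) ox.
      by rewrite lat_form_lvec gX; apply: qf_over.
    + by rewrite rk nfdimE oddD oddM.
    + by apply/(lgram_cyclic rk bX); rewrite gX.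
  - by rewrite rk nfdimE.
  - apply/(has_sdetE _ rk); exists (mxBasis _); split=> //.
    exists 1; first exact: vunit1.
    by rewrite signed_gram_detE gX hf dB expr1n mul1r.
rewrite -nfdimE in rk'.
have [X' [bX' [u uU]]] := (has_sdetE _ rk').1 sL'.
rewrite signed_gram_detE hf => dX'.
apply: (isometric_of_cong rk rk' bX bX'); rewrite gX.
apply: uniq uU dX' _; first exact: (lgram_even rk' bX').
  exact/(lgram_cyclic rk' bX').
by rewrite -(eichler_lgram rk' bX').
Qed.

(** For [e = 1] the model is [H^(n+1) _|_ <N>]. For [e = -1] the hypothesis puts [N] in [p], and the
    model contains the anisotropic plane. In each case the Eichler invariant excludes the other
    normal form. *)
Lemma special_classification n N (e : int) : N \in R -> N != 0 ->
  e = 1 \/ e = -1 -> (N \in U -> e = 1) ->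
  exists L : lattice v,
    [/\ special L, lat_rank L = (2 * n.+1 + 1)%N, has_sdet L (2 * N)
      & eichler L N = e] /\
    forall L' : lattice v,
      [/\ special L', lat_rank L' = (2 * n.+1 + 1)%N, has_sdet L' (2 * N)
        & eichler L' N = e] ->
      isometric L L'.
Proof.
move=> NR N0 he hNe.
have [c rc] := rootless_exists; have dU := rootless_disc rc.
have d0 := vunit_neq0 dU; have [cR _] := rc.
have dU' : 4 * c - 1 \in U by rewrite -opprB vunitN.
have sgn : (-1) ^+ n.+1 * (-1) ^+ n = -1 :> k.
  by rewrite exprS -mulrA -expr2 sqrr_sign mulr1.
case: he hNe => -> hNe.
  apply: (@lattice_classified_by_matrix n (nf n (tern hyp2 N))) => //.
  - by apply/nf_even/tern_even => //; apply: hyp2_even.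
  - by apply/nf_cyclic/tern_cyclic => //; apply: hyp2_GLR.
  - by rewrite nf_det tern_det hyp2_det mulrA sgn; ring.
  - by case: asboolP => // -[]; apply: eichmx_nf.
  - move=> C u eC cC uU dC; case: asboolP => // eich _.
    have [//|[Np h]] := nf_classify rc eC cC uU dC.
    by case: (eichmx_as2 rc N0 Np (eichmx_cong h eich)).
have Np : N \in p by have [/hNe|//] := vring_unit NR.
apply: (@lattice_classified_by_matrix n (nf n (tern (as2 c) (N / (1 - 4 * c))))) => //.
- by apply/nf_even/tern_even; rewrite ?rpredM ?vunitV //; apply: as2_even.
- by apply/nf_cyclic/tern_cyclic; rewrite ?mulf_neq0 ?invr_eq0 //; apply: as2_GLR.
- by rewrite nf_det tern_det as2_det mulrA sgn; field.
- by case: asboolP => // /(eichmx_as2 rc N0 Np).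
- move=> C u eC cC uU dC; case: asboolP => // nE _.
  have [h|[_ //]] := nf_classify rc eC cC uU dC.
  by case: nE; apply: eichmx_cong (cong_sym h) _; apply: eichmx_nf.
Qed.

End LocalField.

Theorem mainTheorem8 (k : fieldType) (v : k -> int) (hk : is_local_field v)
    (hchar : 2%N \notin [pchar k])
    (n : nat) (hn : (1 <= n)%N)
    (N : k) (hN : N \in vring v) (hN0 : N != 0)
    (e : int) (he : e = 1 \/ e = -1) (hNe : N \in vunit v -> e = 1) :
  exists L : lattice v,
    [/\ special L, lat_rank L = (2 * n + 1)%N, has_sdet L (2 * N)
      & eichler L N = e] /\
    forall L' : lattice v,
      [/\ special L', lat_rank L' = (2 * n + 1)%N, has_sdet L' (2 * N)
        & eichler L' N = e] ->
      isometric L L'.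
Proof.
have n2 : 2 != 0 :> k by move: hchar; rewrite inE.
(* The matrices are indexed from rank three, hence the shift of [n] by one. *)
case: n hn => // n _; exact: special_classification.
Qed.
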